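(* Let $n\ge1$, let $\|\cdot\|$ be a norm on $\mathbb{R}^n$, and let $\varepsilon,\Delta>0$. The set $\mathcal{D}$ is convex and compact in the weak topology. Moreover, its extreme points are exactly the staircase distributions, i.e. the probability measures with density $f_\gamma$, $\gamma\in[0,1]$.
   Context: $\mathcal{M}_n(\Delta,\varepsilon)$ is the set of Borel probability measures on $\mathbb{R}^n$ that are absolutely continuous with respect to Lebesgue measure and have a (version of the) density $f$ satisfying $f(x)\le e^{\varepsilon}f(y)$ for all $x,y$ with $\|x-y\|\le\Delta$. $\mathcal{D}\subseteq\mathcal{M}_n(\Delta,\varepsilon)$ is the collection of those probability measures having a density that is lower semicontinuous and of the form $f(x)=\rho(\|x\|)$ with $\rho:[0,\infty)\to[0,\infty)$ non-increasing and satisfying the maximal decay condition $\rho(t+\Delta)=e^{-\varepsilon}\rho(t)$ for all $t\ge0$. For $\gamma\in[0,1]$ the staircase density is $$f_\gamma(x)=a(\gamma)\sum_{k=0}^\infty e^{-k\varepsilon}\,\mathbf{1}_{[(k-1+\gamma)\Delta,(k+\gamma)\Delta)}(\|x\|),$$ with $a(\gamma)>0$ the normalizing constant (for $\gamma=0$ the $k=0$ term does not contribute, and $f_0=f_1$). The weak topology is that of the space of finite signed Borel measures on $\mathbb{R}^n$ tested against bounded continuous functions: $\mu_k\to\mu$ iff $\int g\,d\mu_k\to\int g\,d\mu$ for all bounded continuous $g$. Extreme points are taken in the sense of convex sets in this vector space. *)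

(* Defs.v *)
From HB Require Import structures.
From mathcomp Require Import all_boot all_order all_algebra.
From mathcomp Require Import all_classical all_reals all_analysis.
From mathcomp Require Import measurable_realfun.

Set Implicit Arguments.
Unset Strict Implicit.
Unset Printing Implicit Defensive.

Import Order.TTheory GRing.Theory Num.Theory.
Import numFieldNormedType.Exports.

Local Open Scope classical_set_scope.
Local Open Scope ring_scope.

(* Borel sigma-algebra of R^n. *)
HB.instance Definition _ (R : realType) (n : nat) :=
  @isMeasurable.Build (sigma_display (@open 'rV[R]_n)) 'rV[R]_n <<s open >>
    (@sigma_algebra0 _ setT open) (@sigma_algebraC _ open)
    (@sigma_algebra_bigcup _ setT open).

Section cons_rV.
Context {R : realType} {n : nat}.

Definition cons_rV (p : R * 'rV[R]_n) : 'rV[R]_n.+1 :=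
  row_mx (const_mx p.1 : 'rV_1) p.2.

Lemma cons_rV0 p : cons_rV p ord0 ord0 = p.1.
Proof.
have -> : ord0 = lshift n (ord0 : 'I_1) :> 'I_(1 + n) by exact: val_inj.
by apply: etrans (row_mxEl _ _ _ _) _; rewrite mxE.
Qed.

Lemma cons_rVS p i : cons_rV p ord0 (lift ord0 i) = p.2 ord0 i.
Proof.
have -> : lift ord0 i = rshift 1 i :> 'I_(1 + n) by exact: val_inj.
exact: row_mxEr.
Qed.

Lemma ball_cons_rV (v : 'rV[R]_n.+1) e : cons_rV @^-1` ball v e =
  ball (v ord0 ord0) e `*` ball (\row_i v ord0 (lift ord0 i)) e.
Proof.
apply/seteqP; split=> p /= [].
  move=> e0 h; split; first by have := h ord0 ord0; rewrite cons_rV0.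
  by split=> // i j; rewrite (ord1 i) mxE -cons_rVS; exact: h.
move=> h1 [e0 h2]; split=> // i j; rewrite (ord1 i).
case: (unliftP ord0 j) => [k|] ->; last by rewrite cons_rV0.
by rewrite cons_rVS; have := h2 ord0 k; rewrite mxE.
Qed.

Lemma measurable_cons_rV : measurable_fun setT cons_rV.
Proof.
apply: (@measurability _ _ _ _ setT cons_rV (@open 'rV[R]_n.+1)) => //.
move=> _ [U oU <-]; rewrite setTI.
pose B (qk : 'rV[rat]_n.+1 * nat) : set 'rV[R]_n.+1 :=
  ball (map_mx ratr qk.1 : 'rV[R]_n.+1) (qk.2.+1%:R^-1 : R).
have -> : cons_rV @^-1` U =
    \bigcup_(qk in [set qk | B qk `<=` U]) (cons_rV @^-1` B qk).
  apply/seteqP; split=> [p Up|p [qk /= BU Bp]]; last exact: BU.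
  have /nbhs_ballP[e /= e0 eU] : nbhs (cons_rV p) U by exact: open_nbhs_nbhs.
  pose k := Num.truncn (2 / e).
  have ke : k.+1%:R^-1 + k.+1%:R^-1 <= e :> R.
    rewrite -mulr2n -[leLHS]mulr_natl ler_pdivrMr ?ltr0n// mulrC -ler_pdivrMr//.
    exact/ltW/truncnS_gt.
  have k0 : 0 < k.+1%:R^-1 :> R by rewrite invr_gt0 ltr0n.
  have hq (j : 'I_n.+1) : exists q : rat,
      ball (ratr q : R) k.+1%:R^-1 (cons_rV p ord0 j).
    have [|q] := @rat_in_itvoo R (cons_rV p ord0 j - k.+1%:R^-1)
      (cons_rV p ord0 j + k.+1%:R^-1).
      by rewrite ltrD2l gtrN.
    rewrite in_itv/= => qin; exists q.
    by rewrite -ball_normE /= ltr_distl.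
  have /choice[q {}hq] := hq.
  have Bp : B (\row_j q j, k) (cons_rV p).
    split=> [|i j]; first exact: k0.
    by rewrite (ord1 i) [X in ball X]mxE [X in ratr X]mxE; exact: hq.
  exists (\row_j q j, k) => //= w Bw; apply: eU; apply: le_ball ke _ _.
  by apply: ball_triangle Bw; exact: ball_sym.
rewrite bigcup_mkcond; apply: countable_bigcupT_measurable => [|qk].
  exact: countableP.
case: ifPn => _; last exact: measurable0.
rewrite ball_cons_rV; apply: measurableX.
  rewrite ball_itv; exact: measurable_itv.
apply: (@sub_sigma_algebra _ setT open); exact: (@ball_open R (matrix R 1 n)).
Qed.

Let uncons_rV (v : 'rV[R]_n.+1) : R * 'rV[R]_n :=
  (v ord0 ord0, \row_i v ord0 (lift ord0 i)).

Let cons_rVK : cancel cons_rV uncons_rV.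
Proof.
move=> [x v]; congr pair; first exact: cons_rV0.
by apply/rowP => i; rewrite mxE cons_rVS.
Qed.

Let measurable_uncons_rV : measurable_fun setT uncons_rV.
Proof.
apply: measurable_fun_pair.
  apply: (measurability _ (RGenOpens.measurableE R)).
  move=> _ [_ [a [b ->]] <-]; rewrite setTI; apply: sub_sigma_algebra.
  by apply: open_comp (interval_open _ _) => // v _; exact: coord_continuous.
apply: (@measurability _ _ _ _ setT _ (@open 'rV[R]_n)) => // _ [U oU <-]; rewrite setTI.
apply: sub_sigma_algebra; apply: open_comp oU => v _ A /nbhs_ballP[e /= e0 eA].
apply/nbhs_ballP; exists e => //= w [_ vw]; apply: eA; split=> // i j.
by rewrite !mxE; exact: vw.
Qed.

Lemma pushforward_cons_rV_sigma_finite
    (mu : {sigma_finite_measure set 'rV[R]_n -> \bar R}) :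
  sigma_finite setT (pushforward (lebesgue_measure \x mu)%E cons_rV).
Proof.
have /sigma_finiteP[F [FT ndF Foo]] := sigma_finiteT (@lebesgue_measure R).
have /sigma_finiteP[G [GT ndG Goo]] := sigma_finiteT mu.
exists (fun i => uncons_rV @^-1` (F i `*` G i)).
  apply/seteqP; split=> // v _.
  have [i _ Fi] : (\bigcup_i F i) (uncons_rV v).1 by rewrite -FT.
  have [j _ Gj] : (\bigcup_i G i) (uncons_rV v).2 by rewrite -GT.
  exists (maxn i j) => //; split.
    by move: Fi; exact/subsetPset/ndF/leq_maxl.
  by move: Gj; exact/subsetPset/ndG/leq_maxr.
move=> i; have [mF Fi] := Foo i; have [mG Gi] := Goo i; split.
  by rewrite -[X in measurable X]setTI; apply: measurable_uncons_rV => //;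
    exact: measurableX.
rewrite /pushforward -comp_preimage (_ : uncons_rV \o cons_rV = id).
  by rewrite preimage_id product_measure1E// lte_mul_pinfty// ge0_fin_numE.
by apply/funext => p /=; rewrite cons_rVK.
Qed.

End cons_rV.

Section lebesgue_rV.
Context {R : realType}.

Definition lebesgue_rV_cons n
    (mu : {sigma_finite_measure set 'rV[R]_n -> \bar R}) :
    set 'rV[R]_n.+1 -> \bar R :=
  pushforward (lebesgue_measure \x mu)%E cons_rV.

HB.instance Definition _ n mu := Measure.copy (@lebesgue_rV_cons n mu)
  (@measure_function_pushforward__canonical__measure_function_Measure
    _ _ _ _ _ (lebesgue_measure \x mu)%E cons_rV measurable_cons_rV).

HB.instance Definition _ n mu := Measure_isSigmaFinite.Build _ _ _
  (@lebesgue_rV_cons n mu) (pushforward_cons_rV_sigma_finite mu).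

(* Lebesgue measure on R^n as the n-fold product of the one-dimensional one;
   [lebesgue_rV_box] checks the normalization. *)
Fixpoint lebesgue_rV n : {sigma_finite_measure set 'rV[R]_n -> \bar R} :=
  if n is n'.+1 then lebesgue_rV_cons (lebesgue_rV n') else \d_(0 : 'rV[R]_0).

Lemma lebesgue_rV_box n (a b : 'rV[R]_n) : (forall i, a ord0 i <= b ord0 i) ->
  lebesgue_rV n [set x | forall i, a ord0 i <= x ord0 i <= b ord0 i] =
  (\prod_i (b ord0 i - a ord0 i))%:E.
Proof.
elim: n => [|n IHn] in a b *.
  by move=> _; rewrite big_ord0 /= diracE mem_set// => -[].
pose tl (v : 'rV[R]_n.+1) : 'rV[R]_n := \row_i v ord0 (lift ord0 i).
move=> ab; have tl_ab i : tl a ord0 i <= tl b ord0 i by rewrite !mxE.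
rewrite /= /lebesgue_rV_cons /pushforward.
rewrite (_ : cons_rV @^-1` _ = `[a ord0 ord0, b ord0 ord0]%classic `*`
    [set x : 'rV[R]_n | forall i, tl a ord0 i <= x ord0 i <= tl b ord0 i]); last first.
  apply/seteqP; split=> p /=.
    move=> pab; split; first by have := pab ord0; rewrite cons_rV0 in_itv.
    by move=> i; have := pab (lift ord0 i); rewrite cons_rVS !mxE.
  rewrite in_itv/= => -[p1 p2] i.
  case: (unliftP ord0 i) => [k|] ->; last by rewrite cons_rV0.
  by rewrite cons_rVS; have := p2 k; rewrite !mxE.
have mbox : measurable
    [set x : 'rV[R]_n | forall i, tl a ord0 i <= x ord0 i <= tl b ord0 i].
  rewrite -[X in measurable X]setCK; apply: measurableC.
  apply: (@sub_sigma_algebra _ setT open); apply: closed_openC.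
  rewrite (_ : [set x | _] = \bigcap_(i : 'I_n)
      (fun x : 'rV[R]_n => x ord0 i) @^-1` `[tl a ord0 i, tl b ord0 i]).
    apply: closed_bigI => i _; apply: closed_comp; last exact: itv_closed.
    by move=> x _; exact: coord_continuous.
  apply/seteqP; split=> x /= xab i; first by move=> _; rewrite /= in_itv/=.
  by have := xab i Logic.I; rewrite /= in_itv.
rewrite product_measure1E// IHn// big_ord_recl EFinM.
under eq_bigr do rewrite !mxE.
congr (_ * _)%E; apply: etrans (lebesgue_measure_itv _) _.
rewrite /= lte_fin lt_neqAle ab andbT.
by case: eqVneq => //= ->; rewrite subrr.
Qed.

End lebesgue_rV.

Section signed_measure.
Context d (T : measurableType d) (R : realType).

(* Library charges are functions on all sets, with unconstrained values on
   non-measurable ones. Forcing the value 0 there makes Leibniz equality agree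
   with equality of measures, so that finite signed measures form a genuine
   vector space under the pointwise operations. *)
Definition signed_measure_pred : {pred set T -> R} :=
  fun m => `[< [/\ m set0 = 0, semi_sigma_additive (EFin \o m) &
                forall A, ~ measurable A -> m A = 0] >].

Record signed_measure := SignedMeasure {
  signed_measure_fun :> set T -> R;
  signed_measureP : signed_measure_fun \in signed_measure_pred }.

HB.instance Definition _ := [isSub for signed_measure_fun].
HB.instance Definition _ := [Choice of signed_measure by <:].

Lemma signed_measure_submod_closed : submod_closed signed_measure_pred.
Proof.
split.
  rewrite inE; split => // F _ _ _.
  rewrite (_ : (fun n => _) = cst 0%E); first exact: cvg_cst.
  by apply/funext => n; rewrite big1.
move=> r m1 m2 /asboolP[m10 s1 n1] /asboolP[m20 s2 n2]; rewrite inE; split.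
- by rewrite !fctE m10 m20 scaler0 addr0.
- move=> F mF tF mUF.
  rewrite (_ : (fun n => _) = fun n => (r%:E * \sum_(0 <= i < n) (m1 (F i))%:E +
      \sum_(0 <= i < n) (m2 (F i))%:E)%E); last first.
    by apply/funext => n; rewrite !sumEFin -EFinM -EFinD mulr_sumr -big_split.
  rewrite [X in _ --> X](_ : _ =
      (r%:E * (m1 (\bigcup_n F n))%:E + (m2 (\bigcup_n F n))%:E)%E)//.
  apply: cvgeD => //; last exact: s2.
  by apply: cvgeZl => //; exact: s1.
- by move=> A mA; rewrite !fctE n1// n2// scaler0 addr0.
Qed.

HB.instance Definition _ := GRing.isSubmodClosed.Build R _ signed_measure_pred
  signed_measure_submod_closed.
HB.instance Definition _ := [SubChoice_isSubLmodule of signed_measure by <:].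

Definition charge_of_signed_measure (m : signed_measure) : set T -> \bar R :=
  EFin \o m.

Section charge_of_signed_measure.
Variable m : signed_measure.

Let charge_of_signed_measure0 : charge_of_signed_measure m set0 = 0%E.
Proof.
by have /asboolP[m0 _ _] := signed_measureP m; congr EFin.
Qed.

Let charge_of_signed_measure_fin A :
  measurable A -> charge_of_signed_measure m A \is a fin_num.
Proof. by []. Qed.

Let charge_of_signed_measure_additive :
  semi_sigma_additive (charge_of_signed_measure m).
Proof. by have /asboolP[] := signed_measureP m. Qed.

HB.instance Definition _ := isCharge.Build _ _ _ (charge_of_signed_measure m)
  charge_of_signed_measure0 charge_of_signed_measure_fin
  charge_of_signed_measure_additive.

End charge_of_signed_measure.

Lemma hahn_decomposition_exists (nu : {charge set T -> \bar R}) :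
  exists PN : set T * set T, hahn_decomposition nu PN.1 PN.2.
Proof. by have [P [N nuPN]] := Hahn_decomposition nu; exists (P, N). Qed.

(* Integral against a signed measure through its Jordan decomposition; it does
   not depend on the chosen Hahn decomposition. *)
Definition signed_integral (m : signed_measure) (g : T -> R) : R :=
  let nuPN := projT2 (cid (hahn_decomposition_exists
    (charge_of_signed_measure m))) in
  \int[jordan_pos nuPN]_x g x - \int[jordan_neg nuPN]_x g x.

Definition is_probability (m : signed_measure) : Prop :=
  (forall A, 0 <= m A) /\ m setT = 1.

Definition has_density (mu : {measure set T -> \bar R}) (m : signed_measure)
    (f : T -> R) : Prop :=
  [/\ measurable_fun setT f, forall x, 0 <= f x &
    forall A, measurable A -> (m A)%:E = (\int[mu]_(x in A) (f x)%:E)%E].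

(* Equal to the junk value 0 when [f] does not induce a finite signed measure;
   0 is not a probability measure, hence never a point of the set of measures
   under study. *)
Definition signed_measure_of_density (mu : {measure set T -> \bar R})
    (f : T -> R) : signed_measure :=
  insubd 0 (fun A => if A \in measurable then \int[mu]_(x in A) f x else 0).

End signed_measure.

Definition bounded_continuous (X : topologicalType) (R : realType) :=
  {g : X -> R | continuous g /\ bounded_fun g}.

Section weak_topology.
Context {R : realType} {n : nat}.

(* Coarsest topology making every [signed_integral ^~ g], [g] bounded and
   continuous, continuous. *)
Definition weak_eval (m : signed_measure 'rV[R]_n R) :
    prod_topology (fun _ : bounded_continuous 'rV[R]_n R => R) :=
  fun g => signed_integral m (sval g).

HB.instance Definition _ := Topological.copy (signed_measure 'rV[R]_n R)
  (initial_topology weak_eval).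

End weak_topology.

Definition extreme_points (R : realType) (E : lmodType R) (A : set E) : set E :=
  [set x | A x /\ forall y z t, A y -> A z -> 0 < t < 1 ->
    x = t *: y + (1 - t) *: z -> y = x /\ z = x].

Section norm.
Context {R : realType} {n : nat}.
Variable N : 'rV[R]_n -> R.

(* [N] is an arbitrary norm, unrelated to the sup norm carried by ['rV[R]_n];
   non-negativity follows from these axioms. *)
Definition is_norm : Prop :=
  [/\ forall x y, N (x + y) <= N x + N y,
      forall (a : R) x, N (a *: x) = `|a| * N x &
      forall x, N x = 0 -> x = 0].

Variables Delta epsilon : R.

Definition dp_measures : set (signed_measure 'rV[R]_n R) :=
  [set m | [/\ is_probability m,
    charge_of_signed_measure m `<< lebesgue_rV n &
    exists2 f, has_density (lebesgue_rV n) m f &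
      forall x y, N (x - y) <= Delta -> f x <= expR epsilon * f y]].

Definition maximal_decay (rho : R -> R) : Prop :=
  [/\ forall t, 0 <= t -> 0 <= rho t,
      forall s t, 0 <= s -> s <= t -> rho t <= rho s &
      forall t, 0 <= t -> rho (t + Delta) = expR (- epsilon) * rho t].

Definition max_decay_measures : set (signed_measure 'rV[R]_n R) :=
  [set m | dp_measures m /\ exists rho : R -> R,
    [/\ maximal_decay rho,
        lower_semicontinuous (fun x : 'rV[R]_n => (rho (N x))%:E) &
        has_density (lebesgue_rV n) m (fun x => rho (N x))]].

(* For [0 < Delta] at most one term is nonzero at each [t], so the limit exists. *)
Definition staircase_profile (gamma t : R) : R :=
  limn (fun K => \sum_(0 <= k < K) expR (- (k%:R * epsilon)) *
    \1_(`[(k%:R - 1 + gamma) * Delta, (k%:R + gamma) * Delta[%classic) t).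

Definition staircase_constant (gamma : R) : R :=
  (\int[lebesgue_rV n]_x staircase_profile gamma (N x))^-1.

Definition staircase_density (gamma : R) (x : 'rV[R]_n) : R :=
  staircase_constant gamma * staircase_profile gamma (N x).

Definition staircase_distribution (gamma : R) : signed_measure 'rV[R]_n R :=
  signed_measure_of_density (lebesgue_rV n) (staircase_density gamma).

End norm.

(* Main.v *)
Require Import Defs.
From HB Require Import structures.
From mathcomp Require Import all_boot all_order all_algebra.
From mathcomp Require Import all_classical all_reals all_analysis.
From mathcomp Require Import measurable_realfun.
From mathcomp Require Import ring lra.
Import Order.TTheory GRing.Theory Num.Theory.
Import numFieldNormedType.Exports.
Local Open Scope classical_set_scope.
Local Open Scope ring_scope.
Set Implicit Arguments.
Unset Strict Implicit.
Unset Printing Implicit Defensive.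

(** Lower semicontinuity of [rho (N x)] means right-continuity of [rho], so
    elements of the set correspond bijectively to right-continuous [rho].

    Extreme points: a map [phi] with [phi (e^-epsilon v) = e^-epsilon phi v] such
    that [phi] and [v - phi v] are nondecreasing splits [rho] as
    [phi \o rho + (rho - phi \o rho)]. Taking
    [phi v = (v + s v cos (2 pi ln (v / rho 0) / epsilon)) / 2] with [s] small,
    extremality makes the cosine constant along [rho], i.e. [rho] takes only the
    values [rho 0] and [e^-epsilon rho 0] on [[0, Delta)]: it is a staircase.
    Conversely, if a staircase is a mixture of two nonincreasing profiles, both
    are constant wherever it is, hence proportional to it.

    Compactness: along an ultrafilter the profiles converge pointwise; let [rho]
    be the right-continuous version of the limit. If integrals against some [g]
    did not converge to the one of [rho], one could extract a sequence of
    profiles converging on a countable dense set, hence off the countably many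
    jumps of [rho]; spheres being null, this contradicts dominated convergence
    (the profiles have a common exponential envelope). *)

(** * Boxes and Lebesgue measure *)
Section boxes.
Context {R : realType} {n : nat}.
Implicit Types a b x : 'rV[R]_n.

Definition box a b : set 'rV[R]_n :=
  [set x | forall i, a ord0 i <= x ord0 i <= b ord0 i].

Lemma open_measurable_rV (U : set 'rV[R]_n) : open U -> measurable U.
Proof. exact: sub_sigma_algebra. Qed.

Lemma closed_measurable_rV (U : set 'rV[R]_n) : closed U -> measurable U.
Proof.
move=> cU; rewrite -[U]setCK; apply: measurableC; apply: open_measurable_rV.
exact: closed_openC.
Qed.

Lemma closed_box a b : closed (box a b).
Proof.
rewrite (_ : box a b = \bigcap_(i : 'I_n)
    (fun x : 'rV[R]_n => x ord0 i) @^-1` `[a ord0 i, b ord0 i]).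
  apply: closed_bigI => i _; apply: closed_comp; last exact: itv_closed.
  by move=> x _; exact: coord_continuous.
apply/seteqP; split=> x /= xab i; first by move=> _; rewrite /= in_itv/=.
by have := xab i Logic.I; rewrite /= in_itv.
Qed.

Lemma measurable_box a b : measurable (box a b).
Proof. by apply: closed_measurable_rV; exact: closed_box. Qed.

Lemma setI_box a1 b1 a2 b2 : box a1 b1 `&` box a2 b2 =
  box (\row_i Num.max (a1 ord0 i) (a2 ord0 i))
      (\row_i Num.min (b1 ord0 i) (b2 ord0 i)).
Proof.
apply/seteqP; split => x /= => [[x1 x2] i|h].
  rewrite !mxE ge_max le_min.
  by have /andP[-> ->] := x1 i; have /andP[-> ->] := x2 i.
by split => i; have := h i; rewrite !mxE ge_max le_min => /andP[/andP[? ?] /andP[? ?]]; apply/andP.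
Qed.

Lemma ball_box x (e : R) : 0 < e -> ball x e `<=` box (x - const_mx e) (x + const_mx e).
Proof.
move=> e0 y [_ xy] i; have := xy ord0 i; rewrite !mxE /ball/= => xyi.
by move: xyi; rewrite distrC ltr_distl => /andP[/ltW -> /ltW ->].
Qed.

Lemma box_ball x (e d : R) : 0 < e -> e < d ->
  box (x - const_mx e) (x + const_mx e) `<=` ball x d.
Proof.
move=> e0 ed y yx; split; first exact: lt_trans ed.
move=> i j; rewrite (ord1 i); have := yx j; rewrite !mxE => yxj.
by rewrite /ball/= distrC; apply: le_lt_trans ed; rewrite ler_distl.
Qed.

(** Boxes are stable under intersection, so this presentation lets measures be compared on boxes
    alone. An open set is the countable union of the boxes it contains that have rational centre and
    radius [1 / (k + 1)]. *)
Lemma measurable_boxesE : @measurable _ 'rV[R]_n =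
  <<s [set box a b | a in setT & b in setT] >>.
Proof.
apply/seteqP; split; last first.
  apply: smallest_sub; first exact: sigma_algebra_measurable.
  by move=> _ [a _ [b _ <-]]; exact: measurable_box.
apply: smallest_sub; first exact: smallest_sigma_algebra.
move=> U oU.
pose B (qk : 'rV[rat]_n * nat) : set 'rV[R]_n :=
  box (map_mx ratr qk.1 - const_mx (qk.2.+1%:R^-1))
      (map_mx ratr qk.1 + const_mx (qk.2.+1%:R^-1)).
have -> : U = \bigcup_(qk in [set qk | B qk `<=` U]) B qk.
  apply/seteqP; split=> [p Up|p [qk /= BU Bp]]; last exact: BU.
  have /nbhs_ballP[e /= e0 eU] : nbhs p U by exact: open_nbhs_nbhs.
  (* The point is within [1 / (k + 1)] of the rational centre and the box lies in a ball of twice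
     that radius, so the three radii together must stay below [e]. *)
  pose k := Num.truncn (3 / e).
  have k0 : 0 < k.+1%:R^-1 :> R by rewrite invr_gt0 ltr0n.
  have ke : 3 * k.+1%:R^-1 < e :> R.
    rewrite ltr_pdivrMr ?ltr0n// mulrC -ltr_pdivrMr//.
    exact/truncnS_gt.
  have hq (j : 'I_n) : exists q : rat,
      ball (ratr q : R) k.+1%:R^-1 (p ord0 j).
    have [|q] := @rat_in_itvoo R (p ord0 j - k.+1%:R^-1) (p ord0 j + k.+1%:R^-1).
      by rewrite ltrD2l gtrN.
    rewrite in_itv/= => qin; exists q.
    by rewrite -ball_normE /= ltr_distl.
  have /choice[q {}hq] := hq.
  have qp : ball (map_mx ratr (\row_j q j) : 'rV[R]_n) k.+1%:R^-1 p.
    by split=> // i j; rewrite (ord1 i) !mxE; exact: hq.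
  exists (\row_j q j, k) => /=; last exact: ball_box.
  have kk : k.+1%:R^-1 < 2 * k.+1%:R^-1 :> R by rewrite ltr_pMl// ltr1n.
  move=> y /(box_ball k0 kk) h; apply: eU.
  apply: (@le_ball _ _ _ (k.+1%:R^-1 + 2 * k.+1%:R^-1)).
    by apply: ltW; apply: le_lt_trans ke; move: (k.+1%:R^-1) => c; lra.
  by apply: ball_triangle h; exact: ball_sym.
rewrite bigcup_mkcond; apply: (@countable_bigcupT_measurable _
   (g_sigma_algebraType [set box a b | a in setT & b in setT])) => [|qk].
  exact: countableP.
case: ifPn => _; last exact: measurable0.
by apply: sub_sigma_algebra; do 2 (eexists => //).
Qed.

Lemma box_eq0 a b : ~ (forall i, a ord0 i <= b ord0 i) ->
  box a b = set0.
Proof.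
move=> ab; apply/seteqP; split => // x xab; apply: ab => i.
by have /andP[+ +] := xab i; exact: le_trans.
Qed.

Lemma lebesgue_box_fin a b : (lebesgue_rV n (box a b) < +oo)%E.
Proof.
have [ab|/box_eq0->] := pselect (forall i, a ord0 i <= b ord0 i).
  by rewrite /box lebesgue_rV_box// ltry.
by rewrite measure0.
Qed.

Lemma norm_coord_le x i : `|x ord0 i| <= `|x|.
Proof.
rewrite [leRHS]/Num.norm/= mx_normrE.
by apply: le_trans (le_bigmax _ _ (ord0, i)).
Qed.

Lemma bounded_lebesgue_rV_fin (A : set 'rV[R]_n) (r : R) : measurable A ->
  (forall x, A x -> `|x| <= r) -> (lebesgue_rV n A < +oo)%E.
Proof.
move=> mA Ar; apply: le_lt_trans (lebesgue_box_fin (- const_mx r) (const_mx r)).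
apply: le_measure; rewrite ?inE//.
  exact: measurable_box.
move=> x /Ar xr i; rewrite !mxE -ler_norml; exact: le_trans (norm_coord_le _ _) xr.
Qed.

Lemma open_lebesgue_rV_gt0 (A : set 'rV[R]_n) : open A -> A !=set0 ->
  (0 < lebesgue_rV n A)%E.
Proof.
move=> oA [x Ax].
have /nbhs_ballP[e /= e0 eA] : nbhs x A by exact: open_nbhs_nbhs.
have e20 : 0 < e / 2 by rewrite divr_gt0.
apply: (@lt_le_trans _ _ (lebesgue_rV n (box (x - const_mx (e / 2)) (x + const_mx (e / 2))))).
  rewrite /box lebesgue_rV_box => [|i]; last by rewrite !mxE lerD2l ge0_cp// ltW.
  rewrite lte_fin prodr_gt0// => i _; rewrite !mxE; lra.
apply: le_measure; rewrite ?inE; [exact: measurable_box|exact: open_measurable_rV|].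
apply: subset_trans eA; apply: box_ball => //; lra.
Qed.

End boxes.

(** * Scaling of Lebesgue measure and integrability of exponentials *)

Section lebesgue_rV_facts.
Context {R : realType}.

Lemma continuous_measurable_rV n (f : 'rV[R]_n -> R) :
  continuous f -> measurable_fun setT f.
Proof.
move=> cf; apply: (measurability _ (RGenOpens.measurableE R)).
move=> _ [_ [a [b ->]] <-]; rewrite setTI; apply: open_measurable_rV.
by apply: open_comp (interval_open _ _) => // v _; exact: cf.
Qed.

Lemma continuous_measurable_rV_rV n (f : 'rV[R]_n -> 'rV[R]_n) :
  continuous f -> measurable_fun setT f.
Proof.
move=> cf; apply: (@measurability _ _ _ _ setT f (@open 'rV[R]_n)) => //.
move=> _ [U oU <-]; rewrite setTI; apply: open_measurable_rV.
by apply: open_comp oU => v _; exact: cf.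
Qed.

Lemma measurable_scale_rV n (c : R) :
  measurable_fun setT (fun x : 'rV[R]_n => c *: x).
Proof. by apply: continuous_measurable_rV_rV => x; exact: scaler_continuous. Qed.

(** Both sides are measures in [A]. They agree on boxes, which generate the Borel sets, are stable
    under intersection and exhaust the space with finite measure; uniqueness of measures
    concludes. *)
Lemma lebesgue_rV_scale n (c : R) (A : set 'rV[R]_n) : 0 < c -> measurable A ->
  (lebesgue_rV n ((fun x => c *: x) @^-1` A) =
   ((c ^+ n)^-1)%:E * lebesgue_rV n A)%E.
Proof.
move=> c0 mA.
have cn0 : 0 <= (c ^+ n)^-1 by rewrite invr_ge0 exprn_ge0// ltW.
pose m1 : {measure set 'rV[R]_n -> \bar R} :=
  @measure_function_pushforward__canonical__measure_function_Measure
    _ _ _ _ _ (lebesgue_rV n) _ (measurable_scale_rV (n := n) c).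
pose m2 : {measure set 'rV[R]_n -> \bar R} := mscale (NngNum cn0) (lebesgue_rV n).
have scale_box a b : (fun x : 'rV[R]_n => c *: x) @^-1` box a b =
    box (c^-1 *: a) (c^-1 *: b).
  apply/seteqP; split => x /= xab i; have := xab i; rewrite !mxE.
    by rewrite ler_pdivrMl// ler_pdivlMl.
  by rewrite ler_pdivrMl// ler_pdivlMl.
apply: (@measure_unique _ _ _ _ (fun k => box (- const_mx k%:R) (const_mx k%:R))
  measurable_boxesE _ _ _ m1 m2 _ _ _ mA).
- move=> _ _ [a1 _ [b1 _ <-]] [a2 _ [b2 _ <-]]; rewrite setI_box.
  by do 2 (eexists => //).
- by move=> i; do 2 (eexists => //).
- apply/seteqP; split => // x _; exists (Num.truncn `|x|).+1 => // i.
  rewrite !mxE -ler_norml; apply: le_trans (norm_coord_le _ _) _.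
  by apply/ltW/truncnS_gt.
- move=> _ [a _ [b _ <-]].
  have -> : m1 (box a b) = lebesgue_rV n (box (c^-1 *: a) (c^-1 *: b)).
    by rewrite -scale_box.
  rewrite /m2/= /mscale/=.
  have [ab|nab] := pselect (forall i, a ord0 i <= b ord0 i); last first.
    rewrite (box_eq0 nab) box_eq0 ?measure0 ?mule0//.
    by move=> h; apply: nab => i; have := h i; rewrite !mxE ler_pM2l ?invr_gt0.
  rewrite /box !lebesgue_rV_box//; last first.
    by move=> i; rewrite !mxE ler_pM2l ?invr_gt0.
  rewrite -EFinM; congr EFin.
  under eq_bigr do rewrite !mxE -mulrBr.
  by rewrite big_split/= prodr_const card_ord exprVn.
- by move=> k; rewrite [X in (X < _)%E](_ : _ = lebesgue_rV n
    (box (c^-1 *: (- const_mx k%:R)) (c^-1 *: const_mx k%:R)));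
    [exact: lebesgue_box_fin|rewrite -scale_box].
Qed.

(** By symmetry the integral is twice the one over the half-line, where the integrand is [c^-1]
    times the exponential probability density. *)
Lemma integral_expR_norm_fin (c : R) : 0 < c ->
  (\int[@lebesgue_measure R]_x (expR (- c * `|x|))%:E < +oo)%E.
Proof.
move=> c0.
have cE : continuous (fun x : R => expR (- c * `|x|)).
  move=> x; apply: continuous_comp; last exact: continuous_expR.
  by apply: continuousM; [exact: cst_continuous|exact: norm_continuous].
rewrite ge0_symfun_integralT//=; last first.
  by move=> x /=; rewrite normrN.
apply: lte_mul_pinfty => //.
apply: (@le_lt_trans _ _ (\int[@lebesgue_measure R]_x (c^-1 * exponential_pdf c x)%:E)%E); last first.
  under eq_integral do rewrite EFinM.
  rewrite ge0_integralZl//.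
  - by rewrite integral_exponential_pdf// mule1 ltry.
  - by apply/measurable_EFinP; exact: measurable_exponential_pdf.
  - by move=> x _; rewrite lee_fin exponential_pdf_ge0// ltW.
  - by rewrite lee_fin invr_ge0 ltW.
rewrite integral_mkcond; apply: ge0_le_integral => //.
- move=> x _; rewrite patchE; case: ifP => // _; exact: expR_ge0.
- apply/(measurable_restrictT _ _).1.
    by rewrite -set_itvcy.
  apply: measurable_funTS; apply/measurable_EFinP; exact: continuous_measurable_fun.
- by apply/measurable_EFinP; apply: measurable_funM => //; exact: measurable_exponential_pdf.
move=> x _; rewrite patchE mem_setE/=.
case: ifPn => [x0|_]; last first.
  by rewrite lee_fin mulr_ge0 ?invr_ge0 ?exponential_pdf_ge0// ltW.
by rewrite exponential_pdfE// ger0_norm// mulrA mulVf ?mul1r// gt_eqF.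
Qed.

Lemma continuous_sum_norm n :
  continuous (fun x : 'rV[R]_n => \sum_i `|x ord0 i|).
Proof.
apply: continuous_big => [|i _ x]; first exact: add_continuous.
apply: (@continuous_comp _ _ _ (fun x : 'rV[R]_n => x ord0 i) Num.norm).
  exact: coord_continuous.
exact: norm_continuous.
Qed.

(** The exponential of a sum factors over the coordinates; Tonelli splits off the first one and
    induction handles the rest. *)
Lemma integral_expR_sum_norm_fin n (c : R) : 0 < c ->
  (\int[lebesgue_rV n]_x (expR (- c * \sum_i `|x ord0 i|))%:E < +oo)%E.
Proof.
move=> c0; elim: n => [|n IHn].
  rewrite (_ : \int[_]_x _ = \int[lebesgue_rV 0]_x (cst 1 x))%E; last first.
    by apply: eq_integral => x _; rewrite big_ord0 mulr0 expR0.
  by rewrite integral_cst// mul1e /= diracE; case: (_ \in _); rewrite ltry.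
have ch m : continuous (fun x : 'rV[R]_m => expR (- c * \sum_i `|x ord0 i|)).
  move=> x; apply: continuous_comp; last exact: continuous_expR.
  by apply: continuousM; [exact: cst_continuous|exact: continuous_sum_norm].
have mh m : measurable_fun setT (fun x : 'rV[R]_m => (expR (- c * \sum_i `|x ord0 i|))%:E).
  by apply/measurable_EFinP; exact: continuous_measurable_rV.
have -> : (\int[lebesgue_rV n.+1]_x (expR (- c * \sum_i `|x ord0 i|))%:E =
    \int[lebesgue_measure \x lebesgue_rV n]_p
      (expR (- c * \sum_i `|cons_rV p ord0 i|))%:E)%E.
  have := (@ge0_integral_pushforward _ _ (measurableTypeR R * 'rV[R]_n)%type _ R cons_rV
    measurable_cons_rV (@lebesgue_measure R \x lebesgue_rV n)%E setT
    (fun x : 'rV[R]_n.+1 => (expR (- c * \sum_i `|x ord0 i|))%:E)).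
  rewrite /= => /(_ measurableT (mh _)) h; apply: h.
  by move=> x _; rewrite lee_fin expR_ge0.
rewrite fubini_tonelli1//; last first.
  exact: (measurableT_comp (mh n.+1) (@measurable_cons_rV R n)).
rewrite (eq_integral (fun a : measurableTypeR R => (expR (- c * `|a|))%:E *
    \int[lebesgue_rV n]_x (expR (- c * \sum_i `|x ord0 i|))%:E)%E); last first.
  move=> a _; rewrite -ge0_integralZl//.
  apply: eq_integral => v _; rewrite big_ord_recl cons_rV0/= mulrDr expRD EFinM.
  by under eq_bigr do rewrite cons_rVS.
rewrite ge0_integralZr//.
- apply: lte_mul_pinfty; rewrite ?integral_expR_norm_fin//.
  + by apply: integral_ge0 => x _; rewrite lee_fin expR_ge0.
  + by rewrite ge0_fin_numE ?integral_expR_norm_fin//; apply: integral_ge0 => x _; rewrite lee_fin expR_ge0.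
- apply/measurable_EFinP; apply: continuous_measurable_fun => x.
  apply: continuous_comp; last exact: continuous_expR.
  by apply: continuousM; [exact: cst_continuous|exact: norm_continuous].
- by apply: integral_ge0 => x _; rewrite lee_fin expR_ge0.
Qed.

End lebesgue_rV_facts.

(** * Norms *)
Section norms.
Context {R : realType} {n : nat}.
Variable N : 'rV[R]_n -> R.
Hypothesis normN : is_norm N.
Implicit Types x y : 'rV[R]_n.

Lemma is_normD x y : N (x + y) <= N x + N y. Proof. by case: normN. Qed.
Lemma is_normZ a x : N (a *: x) = `|a| * N x. Proof. by case: normN. Qed.
Lemma is_norm_eq0 x : N x = 0 -> x = 0. Proof. by case: normN => _ _; exact. Qed.

Lemma is_norm0 : N 0 = 0.
Proof. by rewrite -(scale0r 0) is_normZ normr0 mul0r. Qed.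

Lemma is_normN x : N (- x) = N x.
Proof. by rewrite -scaleN1r is_normZ normrN1 mul1r. Qed.

Lemma is_norm_ge0 x : 0 <= N x.
Proof.
by have := is_normD x (- x); rewrite subrr is_norm0 is_normN -mulr2n pmulrn_lge0.
Qed.

Lemma is_norm_ler_distB x y : N x - N y <= N (x - y).
Proof. by rewrite lerBlDr -[in leLHS](subrK y x) is_normD. Qed.

Lemma is_norm_ub : exists2 C, 0 < C & forall x, N x <= C * `|x|.
Proof.
(* The bound comes from expanding [x] in the standard basis; the summand 1 keeps the constant
   positive even when the sum vanishes. *)
exists (1 + \sum_i N (delta_mx ord0 i)).
  by rewrite ltr_pwDl// sumr_ge0// => i _; exact: is_norm_ge0.
move=> x; apply: (@le_trans _ _ (\sum_i N (x ord0 i *: delta_mx ord0 i))).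
  rewrite [in leLHS](row_sum_delta x).
  elim/big_ind2 : _ => [|u a v b ua vb|//]; first by rewrite is_norm0.
  exact: le_trans (is_normD _ _) (lerD _ _).
apply: (@le_trans _ _ (\sum_i `|x| * N (delta_mx ord0 i))).
  apply: ler_sum => i _; rewrite is_normZ ler_wpM2r ?is_norm_ge0//.
  exact: norm_coord_le.
by rewrite -mulr_sumr mulrC ler_wpM2r// lerDr.
Qed.

Lemma is_norm_continuous : continuous N.
Proof.
have [C C0 NC] := is_norm_ub.
move=> x; apply/(@cvgrPdist_lt _ _ _ _ (nbhs_filter (x : 'rV[R]_n))) => e e0.
have eC : 0 < e / C by rewrite divr_gt0.
apply/nbhs_ballP; exists (e / C) => //= y.
rewrite -ball_normE/= => xy.
apply: (@le_lt_trans _ _ (N (x - y))); last first.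
  by apply: le_lt_trans (NC _) _; rewrite mulrC -ltr_pdivlMr.
rewrite ler_norml is_norm_ler_distB andbT lerNl opprB.
by rewrite -[leRHS]is_normN opprB is_norm_ler_distB.
Qed.

(** The constant is the minimum of [N] on the compact unit sphere of the sup norm. If this sphere is
    empty, every vector is zero. *)
Lemma is_norm_lb : exists2 c, 0 < c & forall x, c * `|x| <= N x.
Proof.
pose S := [set x : 'rV[R]_n | `|x| = 1].
have [S0|nS] := pselect (S !=set0); last first.
  exists 1 => // x; rewrite mul1r; have [->|x0] := eqVneq x 0.
    by rewrite normr0 is_norm0.
  exfalso; apply: nS; exists (`|x|^-1 *: x).
  by rewrite /S/= normrZ normfV normr_id mulVf// normr_eq0.
have cS : compact S.
  apply: bounded_closed_compact.
    by exists 1; split => // r r1 x; rewrite /S/= => ->; exact: ltW.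
  apply: (@closed_comp _ _ (fun x : 'rV[R]_n => `|x|) [set 1]) => [x _|].
    exact: norm_continuous.
  exact: closed_eq.
have [c cS1 Nc] := EVT_min_rV S0 cS (continuous_subspaceT is_norm_continuous).
have c1 : `|c| = 1 by move: cS1; rewrite inE.
exists (N c).
  rewrite lt_neqAle is_norm_ge0 andbT eq_sym; apply/eqP => /is_norm_eq0 c0.
  by move: c1; rewrite c0 normr0 => /esym/eqP; rewrite oner_eq0.
move=> x; have [->|x0] := eqVneq x 0; first by rewrite normr0 is_norm0 mulr0.
rewrite -ler_pdivlMr ?normr_gt0// mulrC.
have := Nc (`|x|^-1 *: x); rewrite is_normZ normfV normr_id; apply.
by rewrite inE /S/= normrZ normfV normr_id mulVf// normr_eq0.
Qed.

Lemma is_norm_inhabited t : (1 <= n)%N -> 0 <= t -> exists x, N x = t.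
Proof.
move=> n1 t0; pose u : 'rV[R]_n := const_mx 1.
have u0 : N u != 0.
  apply/eqP => /is_norm_eq0/rowP/(_ (Ordinal n1))/eqP.
  by rewrite !mxE oner_eq0.
exists ((t / N u) *: u).
by rewrite is_normZ ger0_norm ?divr_ge0 ?is_norm_ge0// divfK.
Qed.

Lemma closed_is_norm_ball t : closed [set x | N x <= t].
Proof.
apply: (@closed_comp _ _ N [set s | s <= t]) => [x _|]; last exact: closed_le.
exact: is_norm_continuous.
Qed.

Lemma lebesgue_is_norm_ball_fin t A : measurable A -> A `<=` [set x | N x <= t] ->
  (lebesgue_rV n A < +oo)%E.
Proof.
move=> mA At; have [c c0 Nc] := is_norm_lb.
apply: (@bounded_lebesgue_rV_fin _ _ _ (t / c)) => // x /At/= xt.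
by rewrite ler_pdivlMr// mulrC; exact: le_trans (Nc x) xt.
Qed.

(** For [t > 0], the sphere and the ball of radius [c * t] with [c < 1] are disjoint in the ball of
    radius [t]; letting [c] tend to 1, scaling leaves no room for a sphere of positive measure. *)
Lemma lebesgue_is_norm_sphere0 t : (1 <= n)%N -> lebesgue_rV n [set x | N x = t] = 0%E.
Proof.
move=> n1.
have mS s : measurable [set x | N x = s].
  apply: closed_measurable_rV; apply: (@closed_comp _ _ N [set s]) => [x _|].
    exact: is_norm_continuous.
  exact: closed_eq.
have mB s : measurable [set x | N x <= s].
  by apply: closed_measurable_rV; exact: closed_is_norm_ball.
have fB s : lebesgue_rV n [set x | N x <= s] \is a fin_num.
  by rewrite ge0_fin_numE// (@lebesgue_is_norm_ball_fin s).
have fS s : lebesgue_rV n [set x | N x = s] \is a fin_num.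
  by rewrite ge0_fin_numE// (@lebesgue_is_norm_ball_fin s)// => x /= ->.
have [t0|] := ltP 0 t; last first.
  rewrite le_eqVlt => /predU1P[->|t0]; last first.
    rewrite (_ : [set x | _] = set0) ?measure0//; apply/seteqP; split => // x /= Nx.
    by move: t0; rewrite -Nx ltNge is_norm_ge0.
  rewrite (_ : [set x | _] = box 0 0); last first.
    apply/seteqP; split => x /=; first by move/is_norm_eq0 => -> i; rewrite !mxE lexx.
    move=> x0; rewrite (_ : x = 0) ?is_norm0//; apply/rowP => i.
    by apply/eqP; rewrite eq_le andbC; have := x0 i; rewrite !mxE.
  rewrite /box lebesgue_rV_box => [|i]; last by rewrite !mxE.
  by rewrite (bigD1 (Ordinal n1))//= !mxE subrr mul0r.
pose V := fine (lebesgue_rV n [set x | N x <= t]).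
pose a := fine (lebesgue_rV n [set x | N x = t]).
have V0 : 0 <= V by exact: fine_ge0.
have a0 : 0 <= a by exact: fine_ge0.
(* the sphere of radius [t] misses the ball of radius [c t], of measure [c ^+ n * V] *)
have annulus c : 0 < c -> c < 1 -> a + c ^+ n * V <= V.
  move=> c0 c1; rewrite -lee_fin EFinD EFinM !fineK//.
  have := @lebesgue_rV_scale R n c^-1 [set x | N x <= t].
  rewrite exprVn invrK => <-; [|by rewrite invr_gt0|exact: mB].
  rewrite (_ : _ @^-1` _ = [set x | N x <= c * t]); last first.
    apply/seteqP; split => x /=; rewrite is_normZ gtr0_norm ?invr_gt0//;
    by rewrite ler_pdivrMl.
  rewrite -measureU//; last first.
    apply/seteqP; split => // x /= [-> ]; apply/negP.
    by rewrite -ltNge gtr_pMl.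
  apply: le_measure; rewrite ?inE//; first exact: measurableU.
  move=> x /= [->//|]; move/le_trans; apply.
  by rewrite ger_pMl// ltW.
suff a_eq0 : a = 0 by rewrite -[LHS]fineK// -/a a_eq0.
apply/eqP; rewrite eq_le a0 andbT leNgt; apply/negP => a_gt0.
have bernoulli m (d : R) : 0 < d -> d < 1 -> 1 - (1 - d) ^+ m <= m%:R * d.
  move=> d0 d1; elim: m => [|m IHm]; first by rewrite expr0 subrr mul0r.
  have q1 : (1 - d) ^+ m <= 1 by rewrite exprn_ile1//; lra.
  have dq : d * (1 - d) ^+ m <= d by rewrite ger_pMr.
  rewrite exprS -natr1 (mulrDl m%:R) mul1r [(1 - d) * _]mulrBl mul1r; lra.
pose W := n%:R * V.
have W0 : 0 <= W by rewrite mulr_ge0.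
(* With [c = 1 - d], Bernoulli's inequality bounds [a] by [W * d]; this choice of [d] makes [W * d]
   smaller than [a]. *)
pose d := a / (a + W + 1).
have d0 : 0 < d by rewrite divr_gt0//; lra.
have d1 : d < 1 by rewrite ltr_pdivrMr; lra.
have := annulus (1 - d); rewrite subr_gt0 gtrBl => /(_ d1 d0) h.
have {h} : a <= W * d.
  rewrite /W mulrAC; have := ler_wpM2r V0 (bernoulli n _ d0 d1); lra.
rewrite /d mulrA ler_pdivlMr; last lra.
rewrite leNgt => /negP; apply; nra.
Qed.

(** [N x] dominates a multiple of the sup norm, which is at least the average of the absolute values
    of the coordinates; this reduces the claim to the product case. *)
Lemma integrable_expR_is_norm c : (1 <= n)%N -> 0 < c ->
  (lebesgue_rV n).-integrable setT (fun x => (expR (- c * N x))%:E).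
Proof.
move=> n1 c0.
have mN : measurable_fun setT (fun x => (expR (- c * N x))%:E).
  apply/measurable_EFinP; apply: continuous_measurable_rV => x.
  apply: continuous_comp; last exact: continuous_expR.
  by apply: continuousM; [exact: cst_continuous|exact: is_norm_continuous].
apply/integrableP; split => //.
have [l l0 Nl] := is_norm_lb.
have cl0 : 0 < c * l / n%:R by rewrite divr_gt0 ?mulr_gt0 ?ltr0n.
apply: le_lt_trans (integral_expR_sum_norm_fin n cl0).
apply: ge0_le_integral => //.
- exact: measurableT_comp.
- apply/measurable_EFinP; apply: continuous_measurable_rV => x.
  apply: continuous_comp; last exact: continuous_expR.
  apply: continuousM; first exact: cst_continuous.
  exact: continuous_sum_norm.
- move=> x _; rewrite gee0_abs ?lee_fin ?expR_ge0// ler_expR !mulNr lerN2.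
  apply: (@le_trans _ _ (c * (l * `|x|))); last by rewrite ler_wpM2l// ltW.
  rewrite -!mulrA !ler_wpM2l ?(ltW c0) ?(ltW l0)// ler_pdivrMl ?ltr0n//.
  rewrite mulr_natl -[X in _ *+ X]card_ord -sumr_const ler_sum// => i _.
  exact: norm_coord_le.
Qed.

End norms.

(** * Signed measures with a density *)
Section densities.
Context d (T : measurableType d) (R : realType).
Implicit Types m : signed_measure T R.

Lemma signed_measureNmeasurable m A : ~ measurable A -> m A = 0.
Proof. by have /asboolP[_ _] := signed_measureP m; apply. Qed.

Lemma signed_measure_ext m1 m2 :
  (forall A, measurable A -> m1 A = m2 A) -> m1 = m2.
Proof.
move=> m12; apply: val_inj; apply/funext => A /=.
have [mA|nA] := pselect (measurable A); first exact: m12.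
by rewrite !signed_measureNmeasurable.
Qed.

Lemma has_density_inj (mu : {measure set T -> \bar R}) m1 m2 f :
  has_density mu m1 f -> has_density mu m2 f -> m1 = m2.
Proof.
move=> [_ _ m1f] [_ _ m2f]; apply: signed_measure_ext => A mA.
by apply: EFin_inj; rewrite m1f// m2f.
Qed.

Lemma has_density_ge0 (mu : {measure set T -> \bar R}) m f A :
  has_density mu m f -> 0 <= m A.
Proof.
move=> [mf f0 mE]; have [mA|nA] := pselect (measurable A); last first.
  by rewrite signed_measureNmeasurable.
by rewrite -lee_fin mE//; apply: integral_ge0 => x _; rewrite lee_fin.
Qed.

Lemma has_density_dominates (mu : {measure set T -> \bar R}) m f :
  has_density mu m f -> charge_of_signed_measure m `<< mu.
Proof.
move=> [mf f0 mE]; apply/null_content_dominatesP => A mA A0.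
rewrite /charge_of_signed_measure/= mE//.
by apply: null_set_integral => //; apply/measurable_funTS/measurable_EFinP.
Qed.

(** Integrability makes the induced set function a finite signed measure, so [insubd] returns it and
    not its default value 0. *)
Lemma signed_measure_of_density_has_density (mu : {measure set T -> \bar R}) f :
  (forall x, 0 <= f x) -> mu.-integrable setT (EFin \o f) ->
  has_density mu (signed_measure_of_density mu f) f.
Proof.
move=> f0 fi.
have mf : measurable_fun setT f by apply/measurable_EFinP; exact: measurable_int fi.
have fin A : measurable A -> (\int[mu]_(x in A) (f x)%:E)%E \is a fin_num.
  by move=> mA; apply: integrable_fin_num => //; exact: integrableS fi.
pose F A := if A \in measurable then \int[mu]_(x in A) f x else 0.
have FE A : measurable A -> (F A)%:E = (\int[mu]_(x in A) (f x)%:E)%E.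
  by move=> mA; rewrite /F mem_set// fineK// fin.
have FP : F \in @signed_measure_pred _ T R.
  apply/asboolP; split.
  - by rewrite /F mem_set// Rintegral_set0.
  - move=> G mG tG mUG; rewrite [X in _ --> X]FE//.
    rewrite (_ : (fun _ => _) =
        (fun n => \sum_(0 <= i < n) \int[mu]_(x in G i) (f x)%:E)%E).
      apply: semi_sigma_additive_nng_induced => //; exact/measurable_EFinP.
    by apply/funext => n; apply: eq_bigr => i _; exact: FE.
  - by move=> B nB; rewrite /F memNset.
split => // A mA; rewrite -FE// /signed_measure_of_density.
by have /= -> := insubdK (0 : signed_measure T R) FP.
Qed.

(** * Integration against a signed measure with a density *)

Section signed_integral_density.
Variables (mu : {sigma_finite_measure set T -> \bar R}).
Variables (m : signed_measure T R) (f : T -> R) (mf : has_density mu m f).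
Variables (P N : set T)
  (nuPN : hahn_decomposition (charge_of_signed_measure m) P N).

(** Whatever Hahn decomposition was chosen, [m] is both nonnegative and nonpositive on the
    measurable subsets of [N]. *)
Lemma jordan_neg_density A : measurable A -> jordan_neg nuPN A = 0%E.
Proof.
move=> mA; have [_ [mN negN] _ _] := nuPN.
rewrite jordan_negE cjordan_negE /crestr0/= mem_set// /crestr.
rewrite [X in (- X)%E](_ : _ = 0%E) ?oppe0//; apply/eqP; rewrite eq_le.
rewrite negN//; last exact: measurableI.
by rewrite lee_fin (has_density_ge0 _ mf).
Qed.

Lemma jordan_pos_density A : measurable A ->
  jordan_pos nuPN A = (\int[mu]_(x in A) (f x)%:E)%E.
Proof.
move=> mA; have [_ _ <-//] := mf.
rewrite -[RHS]/(charge_of_signed_measure m A) (jordan_decomp nuPN mA).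
rewrite -[RHS]/(jordan_pos nuPN A + (-1)%:E * jordan_neg nuPN A)%E.
by rewrite jordan_neg_density// mule0 adde0.
Qed.

(** The Radon-Nikodym derivative of the positive part and [f] have the same integral over every
    measurable set, hence agree almost everywhere; a change of variables concludes. *)
Lemma integral_jordan_pos_density (g : T -> R) : measurable_fun setT g ->
  bounded_fun g ->
  (\int[jordan_pos nuPN]_x (g x)%:E = \int[mu]_x (g x * f x)%:E)%E.
Proof.
move=> mg bg; have [mf' f0 mE] := mf.
have dom : jordan_pos nuPN `<< mu.
  by apply: jordan_pos_dominates; exact: has_density_dominates mf.
have ig : (jordan_pos nuPN).-integrable setT (EFin \o g).
  apply: measurable_bounded_integrable => //.
  by rewrite ltey_eq fin_num_measure.
rewrite -(Radon_Nikodym_change_of_variables dom measurableT ig).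
have RNf : ae_eq mu setT (Radon_Nikodym (charge_of_finite_measure (jordan_pos nuPN)) mu)
    (EFin \o f).
  apply: integral_ae_eq => //.
  - exact: Radon_Nikodym_integrable.
  - exact/measurable_EFinP.
  - by move=> E _ mEE; rewrite -Radon_Nikodym_integral//= jordan_pos_density.
apply: ae_eq_integral => //.
- apply: emeasurable_funM; first exact/measurable_EFinP.
  by apply: measurable_int; exact: Radon_Nikodym_integrable.
- by apply/measurable_EFinP; exact: measurable_funM.
- by apply: (ae_eq_trans (ae_eqe_mul2l _ RNf)); apply: aeW => x /=; rewrite EFinM.
Qed.

End signed_integral_density.

Lemma signed_integral_density (mu : {sigma_finite_measure set T -> \bar R})
    m f (g : T -> R) : has_density mu m f -> measurable_fun setT g ->
  bounded_fun g -> signed_integral m g = \int[mu]_x (g x * f x).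
Proof.
move=> mf mg bg; rewrite /signed_integral; set nuPN := projT2 _.
rewrite /Rintegral (integral_jordan_pos_density mf nuPN mg bg).
rewrite [X in _ - fine X](_ : _ = 0%E) ?subr0//.
rewrite (eq_measure_integral mzero) ?integral_measure_zero// => A mA _.
exact: (jordan_neg_density mf nuPN).
Qed.

End densities.

(** * Radial profiles with maximal decay *)
Section profiles.
Context {R : realType} {n : nat}.
Variables (N : 'rV[R]_n -> R) (Delta epsilon : R).
Hypotheses (n1 : (1 <= n)%N) (normN : is_norm N).
Hypotheses (Delta0 : 0 < Delta) (epsilon0 : 0 < epsilon).
Implicit Types (rho : R -> R) (t : R).

Local Notation lam := (lebesgue_rV n).

(** For a nonincreasing [rho] the second clause is right-continuity on the half-line, phrased so
    that a strict lower bound persists at some later time. *)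
Definition profile rho := maximal_decay Delta epsilon rho /\
  forall t c, 0 <= t -> c < rho t -> exists2 u, t < u & c < rho u.

Definition radial rho : signed_measure 'rV[R]_n R :=
  signed_measure_of_density lam (fun x => rho (N x)).

Lemma maximal_decay_iter rho k t : maximal_decay Delta epsilon rho -> 0 <= t ->
  rho (t + k%:R * Delta) = expR (- (k%:R * epsilon)) * rho t.
Proof.
move=> [_ _ dec] t0; elim: k => [|k IHk].
  by rewrite !mul0r addr0 oppr0 expR0 mul1r.
rewrite -natr1 !mulrDl !mul1r addrA dec ?IHk; last first.
  by rewrite addr_ge0// mulr_ge0// ltW.
by rewrite opprD expRD mulrA (mulrC (expR (- epsilon))).
Qed.

(** Removing the [k] full periods contained in [t] leaves a value at most [rho 0]. The factor
    [expR epsilon] pays for the last incomplete period, since [k > t / Delta - 1]. *)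
Lemma maximal_decay_ub rho t : maximal_decay Delta epsilon rho -> 0 <= t ->
  rho t <= expR epsilon * rho 0 * expR (- (epsilon / Delta) * t).
Proof.
move=> rhoP t0; have [rho0 ndrho _] := rhoP.
pose k := Num.truncn (t / Delta).
have tD0 : 0 <= t / Delta by rewrite divr_ge0// ltW.
have /andP[kt tk] : k%:R <= t / Delta < k.+1%:R := truncn_itv tD0.
have s0 : 0 <= t - k%:R * Delta by rewrite subr_ge0 -ler_pdivlMr.
rewrite -[in leLHS](subrK (k%:R * Delta) t) maximal_decay_iter//.
rewrite mulrAC -expRD; apply: ler_pM; rewrite ?expR_ge0 ?rho0// ?ndrho//.
rewrite ler_expR; move: tk; rewrite -natr1 => tk.
have : epsilon * (t / Delta) <= epsilon * (k%:R + 1).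
  by rewrite ler_wpM2l// ltW.
by rewrite mulrA mulrAC mulrDr mulr1 mulNr; lra.
Qed.

Lemma profile_lower_semicontinuous rho : profile rho ->
  lower_semicontinuous (fun x : 'rV[R]_n => (rho (N x))%:E).
Proof.
move=> [[rho0 ndrho _] rcrho] x c; rewrite lte_fin => /(rcrho _ _ (is_norm_ge0 normN x)).
move=> [u xu cu]; exists [set y | N y < u].
  apply: open_nbhs_nbhs; split => //.
  apply: (@open_comp _ _ N [set s | s < u]) => [y _|]; last exact: open_lt.
  exact: is_norm_continuous.
move=> y /= yu; rewrite lte_fin; apply: lt_le_trans cu _.
by rewrite ndrho ?is_norm_ge0// ltW.
Qed.

(** Along a ray spanned by a vector [e] with [N e = 1], the density at [t *: e] is [rho t];
    semicontinuity at this point, tested slightly further out on the ray, gives the required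
    time. *)
Lemma lower_semicontinuous_profile rho : maximal_decay Delta epsilon rho ->
  lower_semicontinuous (fun x : 'rV[R]_n => (rho (N x))%:E) -> profile rho.
Proof.
move=> decrho lsc; split => // t c t0 ct.
have [e Ne] := is_norm_inhabited normN n1 ler01.
have := lsc (t *: e) c; rewrite is_normZ// Ne mulr1 ger0_norm// lte_fin.
move=> /(_ ct)[V /nbhs_ballP[r /= r0 rV] VP].
pose d := r / (`|e| + 1).
have e1 : 0 < `|e| + 1 by rewrite ltr_wpDl.
have d0 : 0 < d by rewrite divr_gt0.
have := VP ((t + d) *: e); rewrite is_normZ// Ne mulr1 gtr0_norm ?ltr_wpDl// lte_fin.
move=> h; exists (t + d); first by rewrite ltrDl.
apply: h; apply: rV; rewrite -ball_normE/= -scalerBl opprD addNKr normrZ normrN gtr0_norm//.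
by rewrite /d mulrAC ltr_pdivrMr// ltr_pM2l// ltrDl.
Qed.

Lemma measurable_profile rho : profile rho ->
  measurable_fun setT (fun x => rho (N x)).
Proof.
move=> /profile_lower_semicontinuous/lower_semicontinuousP lsc.
apply: (measurability _ (RGenOInfty.measurableE R)).
move=> _ [_ [a ->] <-]; rewrite setTI; apply: open_measurable_rV.
rewrite (_ : _ @^-1` _ = [set x | a%:E < (rho (N x))%:E])%E; first exact: lsc.
by apply/seteqP; split => x /=; rewrite in_itv/= andbT lte_fin.
Qed.

Lemma profile_ge0 rho x : profile rho -> 0 <= rho (N x).
Proof. by move=> [[rho0 _ _] _]; exact/rho0/is_norm_ge0. Qed.

Lemma integrable_envelope c : lam.-integrable setT
  (fun x => (c * expR (- (epsilon / Delta) * N x))%:E).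
Proof.
under eq_fun do rewrite EFinM.
by apply: integrableZl => //; apply: integrable_expR_is_norm => //; rewrite divr_gt0.
Qed.

Lemma integrable_profile rho : profile rho ->
  lam.-integrable setT (EFin \o (fun x => rho (N x))).
Proof.
move=> rhoP; apply: le_integrable (integrable_envelope (expR epsilon * rho 0)) => //.
  by apply/measurable_EFinP; exact: measurable_profile.
move=> x _; rewrite /= lee_fin ger0_norm ?profile_ge0// ler_normr.
by rewrite maximal_decay_ub ?is_norm_ge0//; case: rhoP.
Qed.

Lemma radial_has_density rho : profile rho ->
  has_density lam (radial rho) (fun x => rho (N x)).
Proof.
move=> rhoP; apply: signed_measure_of_density_has_density.
  by move=> x; exact: profile_ge0.
exact: integrable_profile.
Qed.

(** The triangle inequality gives [N y <= N x + Delta], and the value of [rho] at [N x + Delta] is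
    known from the decay. *)
Lemma maximal_decay_dp rho x y : maximal_decay Delta epsilon rho ->
  N (x - y) <= Delta -> rho (N x) <= expR epsilon * rho (N y).
Proof.
move=> [rho0 ndrho dec] xy.
have Nx0 := is_norm_ge0 normN x; have Ny0 := is_norm_ge0 normN y.
rewrite -ler_pdivrMl ?expR_gt0// -expRN -dec// ndrho//.
rewrite -lerBlDl; apply: le_trans xy.
by rewrite -[leRHS]is_normN// opprB is_norm_ler_distB.
Qed.

Lemma radial_mass rho : profile rho ->
  radial rho setT = \int[lam]_x rho (N x).
Proof.
move=> /radial_has_density[_ _ /(_ _ measurableT) h].
by apply: EFin_inj; rewrite h /Rintegral -h.
Qed.

Lemma radial_mem rho : profile rho -> radial rho setT = 1 ->
  max_decay_measures N Delta epsilon (radial rho).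
Proof.
move=> rhoP rho1; have dP := radial_has_density rhoP.
have [decP _] := rhoP.
split; last by exists rho; split => //; exact: profile_lower_semicontinuous.
split.
- by split => // A; exact: has_density_ge0 dP.
- exact: has_density_dominates dP.
- by exists (fun x => rho (N x)) => // x y; exact: maximal_decay_dp.
Qed.

(** Convexity, extremality and compactness are all studied through this description by normalized
    profiles. *)
Lemma max_decay_measuresP m : max_decay_measures N Delta epsilon m <->
  exists rho, [/\ profile rho, m setT = 1 & m = radial rho].
Proof.
split=> [[[[m0 m1] _ _] [rho [decP lscP mP]]]|[rho [rhoP m1 mE]]]; last first.
  by rewrite mE; apply: radial_mem; rewrite -?mE.
exists rho; have rhoP := lower_semicontinuous_profile decP lscP.
by split => //; exact: has_density_inj mP (radial_has_density rhoP).
Qed.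

Lemma eq_radial rho1 rho2 : (forall t, 0 <= t -> rho1 t = rho2 t) ->
  radial rho1 = radial rho2.
Proof.
move=> rho12; rewrite /radial; congr signed_measure_of_density.
by apply/funext => x; rewrite rho12// is_norm_ge0.
Qed.

Lemma eq_profile rho1 rho2 : (forall t, 0 <= t -> rho1 t = rho2 t) ->
  profile rho1 -> profile rho2.
Proof.
move=> e [[r0 nd dec] rc]; split; first split.
- by move=> t t0; rewrite -e// r0.
- by move=> s t s0 st; rewrite -!e// ?nd// (le_trans s0).
- by move=> t t0; rewrite -!e// ?dec// addr_ge0// ltW.
- move=> t c t0; rewrite -e// => /(rc _ _ t0)[u tu cu]; exists u => //.
  by rewrite -e// (le_trans t0)// ltW.
Qed.

Lemma profileD a b rho1 rho2 : 0 <= a -> 0 <= b -> profile rho1 -> profile rho2 ->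
  profile (fun t => a * rho1 t + b * rho2 t).
Proof.
move=> a0 b0 [[r10 nd1 dec1] rc1] [[r20 nd2 dec2] rc2]; split; first split.
- by move=> t t0; rewrite addr_ge0// mulr_ge0 ?r10 ?r20.
- by move=> s t s0 st; rewrite lerD// ler_wpM2l ?nd1 ?nd2.
- by move=> t t0; rewrite dec1// dec2// mulrDr; congr (_ + _); rewrite mulrCA.
move=> t c t0 ct.
(* Lowering both profiles by [e] costs [e * (a + b)], less than the available slack; the 1 keeps the
   divisor positive when both weights vanish. *)
pose e := (a * rho1 t + b * rho2 t - c) / (a + b + 1).
have ab : 0 < a + b + 1 by lra.
have e0 : 0 < e by rewrite divr_gt0// subr_gt0.
have [|u tu ru] := rc1 t (rho1 t - e) t0; first lra.
have [|v tv rv] := rc2 t (rho2 t - e) t0; first lra.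
exists (Num.min u v); first by rewrite lt_min tu tv.
have w0 : 0 <= Num.min u v by rewrite le_min !(le_trans t0)// ltW.
have rw1 : rho1 t - e < rho1 (Num.min u v).
  by apply: lt_le_trans ru _; rewrite nd1// ge_min lexx.
have rw2 : rho2 t - e < rho2 (Num.min u v).
  by apply: lt_le_trans rv _; rewrite nd2// ge_min lexx orbT.
have h1 : a * (rho1 t - e) <= a * rho1 (Num.min u v) by rewrite ler_wpM2l// ltW.
have h2 : b * (rho2 t - e) <= b * rho2 (Num.min u v) by rewrite ler_wpM2l// ltW.
have : e * (a + b + 1) = a * rho1 t + b * rho2 t - c by rewrite divfK// gt_eqF.
lra.
Qed.

Lemma radialD a b rho1 rho2 : 0 <= a -> 0 <= b -> profile rho1 -> profile rho2 ->
  radial (fun t => a * rho1 t + b * rho2 t) = a *: radial rho1 + b *: radial rho2.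
Proof.
move=> a0 b0 rho1P rho2P; apply: signed_measure_ext => A mA.
rewrite -[RHS]/(a * radial rho1 A + b * radial rho2 A).
have [_ _ dD] := radial_has_density (profileD a0 b0 rho1P rho2P).
have [_ _ d1] := radial_has_density rho1P.
have [_ _ d2] := radial_has_density rho2P.
apply: EFin_inj; rewrite dD// EFinD !EFinM d1// d2//.
have i1 := integrableS measurableT mA (@subsetT _ A) (integrable_profile rho1P).
have i2 := integrableS measurableT mA (@subsetT _ A) (integrable_profile rho2P).
under eq_integral do rewrite EFinD !EFinM.
by rewrite integralD//= ?integralZl//; exact: integrableZl.
Qed.

Lemma profileZ a rho : 0 <= a -> profile rho -> profile (fun t => a * rho t).
Proof.
move=> a0 rhoP; apply: eq_profile (profileD a0 (lexx 0) rhoP rhoP) => t _.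
by rewrite mul0r addr0.
Qed.

Lemma radialZ a rho : 0 <= a -> profile rho ->
  radial (fun t => a * rho t) = a *: radial rho.
Proof.
move=> a0 rhoP.
rewrite -[RHS]addr0 -(scale0r (radial rho)) -radialD//.
by apply: eq_radial => t _; rewrite mul0r addr0.
Qed.

(** If [rho1 t < rho2 t], right-continuity gives [u > t] with [rho1 t < rho2 u]. On the shell
    [t < N x < u], of positive finite measure, the second density then exceeds the first by a fixed
    amount. *)
Lemma radial_le rho1 rho2 t : profile rho1 -> profile rho2 ->
  radial rho1 = radial rho2 -> 0 <= t -> rho2 t <= rho1 t.
Proof.
move=> rho1P rho2P rE t0; rewrite leNgt; apply/negP => r12.
have [[r10 nd1 _] _] := rho1P; have [[r20 nd2 _] rc2] := rho2P.
have [u tu ru] := rc2 _ _ t0 r12.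
pose A := [set x | t < N x < u].
have oA : open A.
  rewrite (_ : A = N @^-1` `]t, u[); last first.
    by apply/seteqP; split => x /=; rewrite in_itv.
  apply: open_comp => [y _|]; last exact: interval_open.
  exact: is_norm_continuous.
have mA := open_measurable_rV oA.
have A0 : A !=set0.
  have [|x Nx] := @is_norm_inhabited _ _ _ normN ((t + u) / 2) n1; first lra.
  by exists x; rewrite /A/= Nx; lra.
have Afin : lam A \is a fin_num.
  rewrite ge0_fin_numE//; apply: (@lebesgue_is_norm_ball_fin _ _ _ normN u) => //.
  by move=> x /= /andP[_ /ltW].
have lamA : 0 < fine (lam A).
  by rewrite fine_gt0// open_lebesgue_rV_gt0//= -ge0_fin_numE.
have [mr1 _ d1] := radial_has_density rho1P.
have [mr2 _ d2] := radial_has_density rho2P.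
have : ((radial rho1 A)%:E <= (rho1 t)%:E * lam A)%E.
  rewrite d1// -integral_cst//; apply: ge0_le_integral => //.
  - by move=> x _; rewrite lee_fin profile_ge0.
  - by apply/measurable_EFinP; exact: measurable_funTS.
  - by move=> x /= /andP[tx _]; rewrite lee_fin nd1// ltW.
have : ((rho2 u)%:E * lam A <= (radial rho2 A)%:E)%E.
  rewrite d2// -integral_cst//; apply: ge0_le_integral => //.
  - by move=> x _; rewrite lee_fin r20// (le_trans t0)// ltW.
  - by apply/measurable_EFinP; exact: measurable_funTS.
  - by move=> x /= /andP[_ xu]; rewrite lee_fin nd2// ?is_norm_ge0// ltW.
rewrite -rE -(fineK Afin) -!EFinM !lee_fin => h2 h1.
by have := le_trans h2 h1; rewrite ler_pM2r// leNgt ru.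
Qed.

Lemma radial_inj rho1 rho2 t : profile rho1 -> profile rho2 ->
  radial rho1 = radial rho2 -> 0 <= t -> rho1 t = rho2 t.
Proof.
by move=> p1 p2 e t0; apply/eqP; rewrite eq_le !radial_le.
Qed.

Lemma profile_gt0 rho : profile rho -> radial rho setT = 1 -> 0 < rho 0.
Proof.
move=> rhoP m1; have [[r0 nd _] _] := rhoP; rewrite lt_neqAle r0// andbT.
apply/eqP => r00.
have rz t : 0 <= t -> rho t = 0.
  by move=> t0; apply/eqP; rewrite eq_le r0// {1}r00 nd.
have [_ _ /(_ _ measurableT)] := radial_has_density rhoP.
rewrite m1; under eq_integral do rewrite rz ?is_norm_ge0//.
by rewrite integral0 => /eqP; rewrite onee_eq0.
Qed.

Lemma radial_mass_gt0 rho : profile rho -> 0 < rho 0 -> 0 < radial rho setT.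
Proof.
move=> rhoP r0; have [[rge0 nd _] rc] := rhoP.
have [u u0 ru] := rc _ _ (lexx 0) r0.
have [mr _ d] := radial_has_density rhoP.
pose A := [set x | N x < u].
have oA : open A.
  apply: (@open_comp _ _ N [set s | s < u]) => [y _|]; last exact: open_lt.
  exact: is_norm_continuous.
have mA := open_measurable_rV oA.
rewrite -lte_fin d//; apply: (@lt_le_trans _ _ ((rho u)%:E * lam A)%E).
  rewrite mule_gt0 ?lte_fin// open_lebesgue_rV_gt0//.
  by exists 0; rewrite /A/= is_norm0.
rewrite -integral_cst//; apply: (@le_trans _ _ (\int[lam]_(x in A) (rho (N x))%:E)%E).
  apply: ge0_le_integral => //.
  - by move=> x _; rewrite lee_fin ltW.
  - by apply/measurable_EFinP; exact: measurable_funTS.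
  - by move=> x /= xu; rewrite lee_fin nd ?is_norm_ge0// ltW.
apply: ge0_subset_integral => //; first exact/measurable_EFinP.
by move=> x _; rewrite lee_fin profile_ge0.
Qed.

End profiles.

(** * Convexity and extreme points *)
Section log_periodic.
Context {R : realType}.
Implicit Types (a s u v x y : R).

Lemma ler_dist_cos x y : `|cos x - cos y| <= `|x - y|.
Proof.
wlog xy : x y / x <= y.
  by move=> h; have [/h//|/ltW/h] := leP x y; rewrite distrC (distrC y).
have [c _ cE] := @MVT_segment R cos (fun x => - sin x) x y xy
  (fun z _ => is_derive_cos z) (continuous_subspaceT (@continuous_cos R)).
rewrite distrC cE (distrC x) normrM normrN ler_piMl// ler_norml.
by rewrite sin_geN1 sin_le1.
Qed.

(** By the double angle formula, cosine 1 forces the sine of [- x / 2] to vanish, whereas it is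
    positive when [- x / 2] is strictly between 0 and [pi]. *)
Lemma cos_eq1 x : - (pi *+ 2) <= x <= 0 -> cos x = 1 -> x = 0 \/ x = - (pi *+ 2).
Proof.
move=> /andP[x1 x0] cx1.
have [->|x0'] := eqVneq x 0; first by left.
have [->|x1'] := eqVneq x (- (pi *+ 2)); first by right.
have xlt0 : x < 0 by rewrite lt_neqAle x0'.
have xgt : - (pi *+ 2) < x by rewrite lt_neqAle eq_sym x1'.
have : 0 < sin (- x / 2).
  by apply: sin_gt0_pi; move: xgt; rewrite mulr2n => xgt; lra.
have cE : cos (- x / 2 + - x / 2) = 1 by rewrite -splitr cosN.
move: cE; rewrite cosD -!expr2 => cE; have := cos2Dsin2 (- x / 2) => sE.
have s0 : sin (- x / 2) ^+ 2 = 0 by lra.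
by move/eqP: s0; rewrite sqrf_eq0 => /eqP ->; rewrite ltxx.
Qed.

(** Log-periodic: for [a = 2 pi / epsilon] and [u > 0], scaling [u] by [expR (- epsilon)] scales the
    value by the same factor. *)
Definition log_wave a u := u * cos (a * ln u).

(** The variation of the factor [u] costs at most [u - v]; that of the cosine costs
    [a * v * (ln u - ln v)], at most [a * (u - v)] because [ln (1 + x) <= x]. At [v = 0] the
    prefactor absorbs the default value of [ln]. *)
Lemma ler_dist_log_wave a u v : 0 <= a -> 0 <= v -> v <= u ->
  `|log_wave a u - log_wave a v| <= (1 + a) * (u - v).
Proof.
move=> a0; rewrite le_eqVlt => /predU1P[<- u0|v0 vu].
  rewrite /log_wave mul0r !subr0 normrM (ger0_norm u0) mulrDl mul1r.
  apply: (@le_trans _ _ u); last by rewrite lerDl mulr_ge0.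
  by rewrite ler_piMr// ler_norml cos_geN1 cos_le1.
have u0 : 0 < u by exact: lt_le_trans vu.
rewrite (_ : log_wave a u - log_wave a v = (u - v) * cos (a * ln u) +
    v * (cos (a * ln u) - cos (a * ln v))); last by rewrite /log_wave; ring.
apply: le_trans (ler_normD _ _) _; rewrite [leRHS]mulrDl mul1r; apply: lerD.
  rewrite normrM ger0_norm ?subr_ge0// ler_piMr ?subr_ge0//.
  by rewrite ler_norml cos_geN1 cos_le1.
rewrite normrM (gtr0_norm v0).
apply: (@le_trans _ _ (v * (a * (ln u - ln v)))).
  rewrite ler_wpM2l ?(ltW v0)//; apply: le_trans (ler_dist_cos _ _) _.
  by rewrite -mulrBr ger0_norm// mulr_ge0// subr_ge0 ler_ln.
rewrite mulrCA ler_wpM2l// -ln_div ?posrE// -ler_pdivlMl//.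
have -> : u / v = 1 + (u / v - 1) by rewrite addrC subrK.
apply: le_trans (le_ln1Dx _) _.
  by rewrite -subr_gt0 opprK addrC addrCA subrr addr0 divr_gt0.
by rewrite mulrBr mulVf ?gt_eqF// mulrC.
Qed.

End log_periodic.

(** * Convexity, and extreme points take two values per period *)

Section extreme.
Context {R : realType} {n : nat}.
Variables (N : 'rV[R]_n -> R) (Delta epsilon : R).
Hypotheses (n1 : (1 <= n)%N) (normN : is_norm N).
Hypotheses (Delta0 : 0 < Delta) (epsilon0 : 0 < epsilon).
Implicit Types (rho : R -> R) (t : R).

Local Notation lam := (lebesgue_rV n).
Local Notation profile := (profile Delta epsilon).
Local Notation radial := (radial N).
Local Notation D := (max_decay_measures N Delta epsilon).

Lemma convex_max_decay : convex_set D.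
Proof.
move=> x y k; rewrite !inE.
move=> /(max_decay_measuresP n1 normN Delta0 epsilon0)[r1 [r1P m1 xE]].
move=> /(max_decay_measuresP n1 normN Delta0 epsilon0)[r2 [r2P m2 yE]].
have k0 : 0 <= k%:num by [].
have k1 : 0 <= 1 - k%:num by rewrite subr_ge0.
rewrite -[conv _ _ _]/(k%:num *: (x : signed_measure _ _) + (1 - k%:num) *: (y : signed_measure _ _)).
rewrite xE yE -(radialD n1 normN Delta0 epsilon0)//.
apply: (radial_mem n1 normN Delta0 epsilon0); first exact: profileD.
rewrite (radialD n1 normN Delta0 epsilon0)// -xE -yE.
by rewrite -[LHS]/(k%:num * x setT + (1 - k%:num) * y setT) m1 m2 !mulr1 addrC subrK.
Qed.

(** The decay condition determines a profile from one period. *)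
Lemma decay_ext rho1 rho2 : maximal_decay Delta epsilon rho1 ->
  maximal_decay Delta epsilon rho2 ->
  (forall t, 0 <= t -> t < Delta -> rho1 t = rho2 t) ->
  forall t, 0 <= t -> rho1 t = rho2 t.
Proof.
move=> d1 d2 e t t0.
have tD0 : 0 <= t / Delta by rewrite divr_ge0// ltW.
have /andP[kt tk] := truncn_itv tD0.
set k := Num.truncn _ in kt tk.
have s0 : 0 <= t - k%:R * Delta by rewrite subr_ge0 -ler_pdivlMr.
rewrite -(subrK (k%:R * Delta) t) !(maximal_decay_iter (epsilon := epsilon))// e//.
by move: tk; rewrite ltr_pdivrMr// -natr1 mulrDl mul1r; lra.
Qed.

(** The upper Lipschitz bound transfers right-continuity: over any time interval [phi \o rho] drops
    by no more than [rho] does. *)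
Lemma profile_comp (phi : R -> R) rho : (forall v, 0 <= v -> 0 <= phi v) ->
  (forall u v, 0 <= v -> v <= u -> 0 <= phi u - phi v <= u - v) ->
  (forall v, 0 <= v -> phi (expR (- epsilon) * v) = expR (- epsilon) * phi v) ->
  profile rho -> profile (phi \o rho).
Proof.
move=> phi0 philip phidec [[r0 nd dec] rc]; split; first split.
- by move=> t t0; rewrite /= phi0 ?r0.
- move=> s t s0 st /=; have t0 := le_trans s0 st.
  by have /andP[+ _] := philip _ _ (r0 _ t0) (nd _ _ s0 st); rewrite subr_ge0.
- by move=> t t0 /=; rewrite dec// phidec ?r0.
move=> t c t0 /= ct; have [|u tu ru] := rc t (rho t - (phi (rho t) - c)) t0.
  by rewrite gtrBl subr_gt0.
exists u => //; have u0 : 0 <= u by rewrite (le_trans t0)// ltW.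
have := philip (rho t) (rho u) (r0 _ u0) (nd _ _ t0 (ltW tu)); lra.
Qed.

(** The two values are the largest one on a period and the one reached at time [Delta]. *)
Definition two_step rho := forall t, 0 <= t -> t < Delta ->
  rho t = rho 0 \/ rho t = expR (- epsilon) * rho 0.

Lemma extreme_two_step rho : profile rho ->
  extreme_points D (radial rho) -> two_step rho.
Proof.
move=> rhoP [Drho ext].
have m1 : radial rho setT = 1 by case: Drho => -[[]].
have M0 := profile_gt0 n1 normN Delta0 epsilon0 rhoP m1.
set M := rho 0 in M0.
have [decP _] := rhoP; have [rge0 nd dec] := decP.
have rgt0 t : 0 <= t -> 0 < rho t.
  move=> t0; apply: (@lt_le_trans _ _ (rho (0 + (Num.truncn (t / Delta)).+1%:R * Delta))).
    by rewrite (maximal_decay_iter (epsilon := epsilon))// mulr_gt0 ?expR_gt0.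
  rewrite nd// add0r -ler_pdivrMr//; apply/ltW/truncnS_gt.
(* One decay factor then shifts the phase of the cosine by exactly one full turn. *)
pose a := pi *+ 2 / epsilon.
have a0 : 0 < a by rewrite divr_gt0// mulrn_wgt0// pi_gt0.
(* This gives [d * (1 + a) <= 1], so that perturbations of amplitude [d] of either sign are
   1-Lipschitz, and [d < 1], so that both parts are positive at time 0. *)
pose d := (1 + a)^-1 / 2.
have d0 : 0 < d by rewrite divr_gt0// invr_gt0; lra.
have da : d * (1 + a) <= 1 by rewrite /d mulrAC mulVf ?gt_eqF//; lra.
have d1 : d < 1 by apply: lt_le_trans da; rewrite ltr_pMr//; lra.
(* Dividing by [M] sets the phase to 0 at the top value; [phi d] and [phi (- d)] add up to the
   identity. *)
pose phi s v := (v + s * (M * log_wave a (v / M))) / 2.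
have phiP s : `|s| = d -> profile (phi s \o rho).
  move=> sd; have lip u v : 0 <= v -> v <= u ->
      `|s * (M * log_wave a (u / M)) - s * (M * log_wave a (v / M))| <= u - v.
    move=> v0 vu; rewrite -mulrBr -mulrBr !normrM sd (gtr0_norm M0).
    have := @ler_dist_log_wave _ a (u / M) (v / M) (ltW a0).
    rewrite divr_ge0 ?(ltW M0)// ler_pM2r ?invr_gt0// => /(_ isT vu) h.
    apply: (@le_trans _ _ (d * (M * ((1 + a) * (u / M - v / M))))).
      by rewrite ler_pM2l// ler_pM2l.
    rewrite (_ : d * _ = d * (1 + a) * (u - v)); last by field; rewrite gt_eqF.
    by rewrite ler_piMl// subr_ge0.
  have phi00 : phi s 0 = 0 by rewrite /phi /log_wave !mul0r mulr0 mulr0 addr0 mul0r.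
  apply: profile_comp => //.
  - move=> v v0; have := lip v 0 (lexx _) v0.
    rewrite mul0r {2}/log_wave mul0r !mulr0 !subr0 ler_norml => /andP[h _].
    by rewrite /phi; lra.
  - move=> u v v0 vu; have := lip _ _ v0 vu; rewrite ler_norml /phi; lra.
  - move=> v; rewrite le_eqVlt => /predU1P[<-|v0]; first by rewrite mulr0 phi00 mulr0.
    rewrite /phi; have -> : log_wave a (expR (- epsilon) * v / M) =
        expR (- epsilon) * log_wave a (v / M).
      rewrite /log_wave -!mulrA; congr (_ * (_ * (_ * _))).
      rewrite mulrA lnM ?posrE ?expR_gt0 ?divr_gt0// expRK mulrDr mulrN /a divfK ?gt_eqF// addrC.
      by rewrite -[LHS]cosD2pi subrK mulrA.
    ring.
have p1P := phiP d (gtr0_norm d0).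
have p2P : profile (phi (- d) \o rho) by apply: phiP; rewrite normrN gtr0_norm.
have phi12 v : phi d v + phi (- d) v = v by rewrite /phi; field.
have phiM s : phi s M = M * (1 + s) / 2.
  by rewrite /phi /log_wave divff ?gt_eqF// ln1 mulr0 cos0; ring.
have mD : 1 = radial (phi d \o rho) setT + radial (phi (- d) \o rho) setT.
  rewrite -m1 -[RHS]/((radial (phi d \o rho) + radial (phi (- d) \o rho)) setT).
  rewrite -(scale1r (radial (phi d \o rho))) -(scale1r (radial (phi (- d) \o rho))).
  rewrite -(radialD n1 normN Delta0 epsilon0)//.
  by congr (signed_measure_fun _ _); apply: eq_radial => // t _; rewrite !mul1r /= phi12.
set q1 := radial (phi d \o rho) setT in mD.
set q2 := radial (phi (- d) \o rho) setT in mD.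
have q1_gt0 : 0 < q1.
  apply: (radial_mass_gt0 n1 normN Delta0 epsilon0) => //=.
  by rewrite -/M phiM divr_gt0// mulr_gt0//; lra.
have q2_gt0 : 0 < q2.
  apply: (radial_mass_gt0 n1 normN Delta0 epsilon0) => //=.
  by rewrite -/M phiM divr_gt0// mulr_gt0//; lra.
have memD s : 0 < radial (phi s \o rho) setT -> profile (phi s \o rho) ->
    D ((radial (phi s \o rho) setT)^-1 *: radial (phi s \o rho)).
  move=> q0 qP; have qi0 : 0 <= (radial (phi s \o rho) setT)^-1 by rewrite invr_ge0 ltW.
  rewrite -(radialZ n1 normN Delta0 epsilon0)//.
  apply: (radial_mem n1 normN Delta0 epsilon0); first exact: profileZ.
  rewrite (radialZ n1 normN Delta0 epsilon0)//.
  by rewrite -[LHS]/(_^-1 * _) mulVf// gt_eqF.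
have [] := ext _ _ q1 (memD _ q1_gt0 p1P) (memD _ q2_gt0 p2P).
- by rewrite q1_gt0; lra.
- have -> : 1 - q1 = q2 by lra.
  rewrite !scalerA !divff ?gt_eqF// -(radialD n1 normN Delta0 epsilon0)//.
  by apply: eq_radial => // t _; rewrite !mul1r /= phi12.
move=> e1 _ t t0 tD.
have q1i : 0 <= q1^-1 by rewrite invr_ge0 ltW.
have rE s : 0 <= s -> q1^-1 * phi d (rho s) = rho s.
  move=> s0; move: e1; rewrite -(radialZ n1 normN Delta0 epsilon0)// => e1.
  exact: (radial_inj n1 normN Delta0 epsilon0 (profileZ Delta0 q1i p1P) rhoP e1 s0).
(* By extremality [phi d \o rho] equals [q1] times [rho]. Time 0, where the cosine is 1, fixes the
   factor; comparison at time [t] then forces the cosine to be 1 there as well. *)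
have q1E : q1 = (1 + d) / 2.
  have := rE _ (lexx 0); rewrite -/M phiM => /(canRL (mulKf _)) h.
  have := h ltac:(by rewrite gt_eqF// invr_gt0).
  rewrite invrK -mulrA mulrC => /(mulIf _) ->//.
  by rewrite gt_eqF.
have := rE _ t0 => /(canRL (mulKf _)) h.
have {}h := h ltac:(by rewrite gt_eqF// invr_gt0).
rewrite invrK q1E /phi in h.
have Ma := rgt0 _ t0.
have wave1 : cos (a * ln (rho t / M)) = 1.
  have wE : M * log_wave a (rho t / M) = rho t * cos (a * ln (rho t / M)).
    by rewrite /log_wave mulrA [M * _]mulrC divfK// gt_eqF.
  rewrite wE in h.
  have : (d * rho t) * cos (a * ln (rho t / M)) = (d * rho t) * 1 by lra.
  by apply: mulfI; rewrite gt_eqF// mulr_gt0.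
(* Within one period the phase stays in [[-2 pi, 0]], and the two ends of this interval correspond
   to the two allowed values. *)
have lnlb : - epsilon <= ln (rho t / M) <= 0.
  apply/andP; split; last first.
    by rewrite ln_le0// ler_pdivrMr// mul1r nd.
  rewrite -ler_expR lnK ?posrE ?divr_gt0// ler_pdivlMr//.
  by rewrite -dec// nd ?add0r// ltW.
have [] := @cos_eq1 _ (a * ln (rho t / M)) _ wave1.
- have -> : - (pi *+ 2) = a * - epsilon :> R by rewrite /a mulrN divfK// gt_eqF.
  by rewrite ler_pM2l// pmulr_rle0.
- move=> /eqP; rewrite mulf_eq0 gt_eqF//= => /eqP l0; left.
  have : rho t / M = 1 by rewrite -[LHS]lnK ?posrE ?divr_gt0// l0 expR0.
  by move=> /(canRL (divfK _)); rewrite mul1r; apply; rewrite gt_eqF.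
- have -> : - (pi *+ 2) = a * - epsilon :> R by rewrite /a mulrN divfK// gt_eqF.
  move=> /(mulfI _) l0; right.
  have : rho t / M = expR (- epsilon).
    by rewrite -[LHS]lnK ?posrE ?divr_gt0// l0// gt_eqF.
  by move=> /(canRL (divfK _)); apply; rewrite gt_eqF.
Qed.

End extreme.

(** * Staircases are exactly the extreme points *)

Section staircase.
Context {R : realType} {n : nat}.
Variables (N : 'rV[R]_n -> R) (Delta epsilon : R).
Hypotheses (n1 : (1 <= n)%N) (normN : is_norm N).
Hypotheses (Delta0 : 0 < Delta) (epsilon0 : 0 < epsilon).
Implicit Types (rho : R -> R) (t g : R).

Local Notation lam := (lebesgue_rV n).
Local Notation profile := (profile Delta epsilon).
Local Notation radial := (radial N).
Local Notation D := (max_decay_measures N Delta epsilon).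

(* The index of the only nonzero term of the staircase sum at [t]. *)
Definition step_index g t := Num.truncn (t / Delta + 1 - g).

Lemma step_index_arg_ge0 g t : g <= 1 -> 0 <= t -> 0 <= t / Delta + 1 - g.
Proof. by move=> g1 t0; rewrite -addrA addr_ge0 ?subr_ge0// divr_ge0// ltW. Qed.

(** The argument of [step_index] is nonnegative here, so truncation is a floor, and [t] lies in the
    [j]-th half-open interval exactly when [j] is this floor. Partial sums are constant once that
    term is included. *)
Lemma staircase_profileE g t : g <= 1 -> 0 <= t ->
  staircase_profile Delta epsilon g t = expR (- ((step_index g t)%:R * epsilon)).
Proof.
move=> g1 t0; rewrite /staircase_profile; set k := step_index g t.
apply: cvg_lim => //; apply: cvg_near_cst; exists k.+1 => // K /= kK.
have x0 := step_index_arg_ge0 g1 t0.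
have stepE j : (\1_(`[(j%:R - 1 + g) * Delta, (j%:R + g) * Delta[%classic : set R) t : R)
    = (k == j)%:R.
  rewrite indicE /k /step_index truncn_eq// mem_setE in_itv/=.
  rewrite -ler_pdivlMr// -ltr_pdivrMr// -natr1.
  have -> : (j%:R - 1 + g <= t / Delta) = (j%:R <= t / Delta + 1 - g).
    by apply/idP/idP; lra.
  have -> // : (t / Delta < j%:R + g) = (t / Delta + 1 - g < j%:R + 1).
  by apply/idP/idP; lra.
rewrite big_mkord (bigD1 (Ordinal kK))//= stepE eqxx mulr1 big1 ?addr0// => j jk.
rewrite stepE; case: eqVneq => [kj|]; last by rewrite mulr0.
by case/eqP: jk; apply: val_inj.
Qed.

Lemma step_index_le g s t : s <= t -> (step_index g s <= step_index g t)%N.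
Proof.
by move=> st; apply: le_truncn; rewrite lerB// lerD// ler_pM2r// invr_gt0.
Qed.

Lemma step_indexD g t : g <= 1 -> 0 <= t ->
  step_index g (t + Delta) = (step_index g t).+1.
Proof.
move=> g1 t0; have x0 := step_index_arg_ge0 g1 t0.
apply: truncn_def; have := truncn_itv x0; rewrite -/(step_index g t).
by rewrite mulrDl divff ?gt_eqF// -!natr1; lra.
Qed.

Lemma staircase_profile_profile g : g <= 1 ->
  profile (staircase_profile Delta epsilon g).
Proof.
move=> g1; apply: (@eq_profile R Delta epsilon Delta0 (fun t => expR (- ((step_index g t)%:R * epsilon)))) => //.
  by move=> t t0; rewrite staircase_profileE.
split; first split.
- by move=> t _; exact: expR_ge0.
- by move=> s t s0 st; rewrite ler_expR lerN2 ler_pM2r// ler_nat step_index_le.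
- by move=> t t0; rewrite step_indexD// -natr1 mulrDl mul1r opprD addrC expRD.
move=> t c t0 ct; have x0 := step_index_arg_ge0 g1 t0.
have /andP[kx xk] := truncn_itv x0; rewrite -/(step_index g t) in kx xk.
pose x := t / Delta + 1 - g.
(* Halfway from [t] to the next jump, hence on the same step. *)
pose u := t + ((step_index g t).+1%:R - x) / 2 * Delta.
have tu : t < u by rewrite ltrDl mulr_gt0// divr_gt0// subr_gt0.
exists u => //.
suff -> : step_index g u = step_index g t by [].
apply: truncn_def; rewrite /u mulrDl mulfK ?gt_eqF//.
by apply/andP; split; rewrite /x; lra.
Qed.

Lemma staircase_two_step g : g <= 1 ->
  two_step Delta epsilon (staircase_profile Delta epsilon g).
Proof.
move=> g1 t t0 tD; rewrite !staircase_profileE//.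
have k0t : (step_index g 0 <= step_index g t)%N by exact: step_index_le.
have : (step_index g t <= (step_index g 0).+1)%N.
  by rewrite -step_indexD// add0r; apply/step_index_le/ltW.
rewrite leq_eqVlt ltnS => /predU1P[->|tk0].
  by right; rewrite -expRD -natr1 mulrDl mul1r opprD addrC.
have -> : step_index g t = step_index g 0 by apply/eqP; rewrite eqn_leq tk0.
by left.
Qed.

(** The times in [[0, Delta)] at which [rho] still equals [rho 0] form an interval starting at 0,
    open on the right by right-continuity; [g] is its length divided by [Delta]. *)
Lemma two_step_staircase rho : profile rho -> 0 < rho 0 ->
  two_step Delta epsilon rho -> exists2 g, 0 <= g <= 1 &
    forall t, 0 <= t -> rho t = rho 0 * staircase_profile Delta epsilon g t.
Proof.
move=> [decP rc] r0 two; have [rge0 nd _] := decP.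
have e1 : expR (- epsilon) < 1 by rewrite expR_lt1 oppr_lt0.
have er : expR (- epsilon) * rho 0 < rho 0 by rewrite gtr_pMl.
pose S := [set t | [/\ 0 <= t, t < Delta & rho t = rho 0]].
have S0 : S 0 by [].
have hS : has_sup S.
  by split; [exists 0|exists Delta => t [_ /ltW]].
have next t : S t -> exists2 u, t < u & S u.
  move=> [t0 tD rt]; have [|u tu ru] := rc t (expR (- epsilon) * rho 0) t0.
    by rewrite rt.
  (* The midpoint keeps the new time below [Delta]; the value there still exceeds the lower step, so
     it is [rho 0]. *)
  exists (Num.min u ((t + Delta) / 2)); first by rewrite lt_min tu; lra.
  have w0 : 0 <= Num.min u ((t + Delta) / 2) by rewrite le_min; apply/andP; split; lra.
  have wD : Num.min u ((t + Delta) / 2) < Delta by rewrite gt_min; apply/orP; right; lra.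
  split => //; have [//|rw] := two _ w0 wD.
  have : rho u <= rho (Num.min u ((t + Delta) / 2)) by rewrite nd// ge_min lexx.
  by rewrite rw leNgt ru.
have supS_ub t : S t -> t < sup S.
  move=> /next[u tu Su]; apply: lt_le_trans tu _.
  by apply: sup_upper_bound.
have sup0 : 0 < sup S by exact: supS_ub.
have supD : sup S <= Delta by apply: ge_sup; [exists 0|move=> t [_ /ltW]].
have gD : sup S / Delta <= 1 by rewrite ler_pdivrMr// mul1r.
exists (sup S / Delta); first by rewrite gD divr_ge0// ltW.
have [decs _] := staircase_profile_profile gD.
have decr : maximal_decay Delta epsilon
    (fun t => rho 0 * staircase_profile Delta epsilon (sup S / Delta) t).
  have [s0 snd sdec] := decs; split.
  - by move=> t t0; rewrite mulr_ge0 ?s0// ltW.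
  - by move=> s t s0' st; rewrite ler_pM2l// snd.
  - by move=> t t0; rewrite sdec// mulrCA.
apply: (decay_ext Delta0 decP decr) => t t0 tD.
have tD1 : t / Delta < 1 by rewrite ltr_pdivrMr// mul1r.
have tD0 : 0 <= t / Delta by rewrite divr_ge0// ltW.
rewrite staircase_profileE//; have [tS|St] := ltP t (sup S).
  have [s [s0 sD rs] ts] := sup_gt (proj1 hS) tS.
  have -> : step_index (sup S / Delta) t = 0%N.
    apply: truncn_def; have : t / Delta < sup S / Delta by rewrite ltr_pM2r// invr_gt0.
    by move=> ?; apply/andP; split; lra.
  rewrite mul0r oppr0 expR0 mulr1; apply/eqP; rewrite eq_le nd//=.
  by rewrite -rs nd// ltW.
have -> : step_index (sup S / Delta) t = 1%N.
  apply: truncn_def; have : sup S / Delta <= t / Delta by rewrite ler_pM2r// invr_gt0.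
  have : 0 < sup S / Delta by rewrite divr_gt0.
  by move=> ? ?; apply/andP; split; lra.
rewrite mul1r mulrC; have [rt|//] := two t t0 tD.
by have := supS_ub t; rewrite ltNge St => /(_ (And3 t0 tD rt)).
Qed.

(** Two nonincreasing functions with a constant positive mixture on an interval are constant there.
    Each component is thus proportional to [rho], and total mass 1 makes the factor 1. *)
Lemma two_step_extreme rho : profile rho -> radial rho setT = 1 ->
  two_step Delta epsilon rho -> extreme_points D (radial rho).
Proof.
move=> rhoP m1 two; split; first exact: (radial_mem n1 normN Delta0 epsilon0).
have r0 := profile_gt0 n1 normN Delta0 epsilon0 rhoP m1.
have [decP _] := rhoP; have [_ _ dec] := decP.
have key r1 r2 s : profile r1 -> profile r2 -> 0 < s -> s < 1 ->
    (forall t, 0 <= t -> rho t = s * r1 t + (1 - s) * r2 t) ->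
    radial r1 setT = 1 -> radial r1 = radial rho.
  move=> r1P r2P s0 s1 rE q1; have [[_ nd1 dec1] _] := r1P.
  have [[_ nd2 _] _] := r2P; have [dec1P _] := r1P.
  have flat t u : 0 <= t -> t <= u -> rho t = rho u -> r1 t = r1 u.
    move=> t0 tu; have u0 := le_trans t0 tu; rewrite !rE// => e.
    apply/eqP; rewrite eq_le (nd1 _ _ t0 tu) andbT -(ler_pM2l s0).
    have : (1 - s) * r2 u <= (1 - s) * r2 t by rewrite ler_wpM2l ?nd2// subr_ge0 ltW.
    lra.
  have prop t : 0 <= t -> r1 t = r1 0 / rho 0 * rho t.
    move=> t0; have c0 : 0 <= r1 0 / rho 0.
      by rewrite divr_ge0 ?(ltW r0)//; case: dec1P => + _ _; exact.
    have [decr _] := profileZ Delta0 c0 rhoP.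
    apply: (decay_ext Delta0 dec1P decr) => // {}t {}t0 tD.
    have [rt|rt] := two t t0 tD.
      by rewrite rt divfK ?gt_eqF//; apply/esym/flat.
    (* The lower step extends up to time [Delta], where the decay condition expresses [r1] through
       [r1 0]. *)
    rewrite rt mulrCA divfK ?gt_eqF// -dec1// add0r; apply: flat; rewrite ?(ltW tD)//.
    by rewrite rt -dec// add0r.
  have c0 : 0 <= r1 0 / rho 0.
    by rewrite divr_ge0 ?(ltW r0)//; case: dec1P => + _ _; exact.
  have e : radial r1 = (r1 0 / rho 0) *: radial rho.
    by rewrite -(radialZ n1 normN Delta0 epsilon0)//; exact: eq_radial.
  have : radial r1 setT = r1 0 / rho 0.
    by rewrite e -[LHS]/((r1 0 / rho 0) * radial rho setT) m1 mulr1.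
  by rewrite q1 e => <-; rewrite scale1r.
move=> y z s.
move=> /(max_decay_measuresP n1 normN Delta0 epsilon0)[r1 [r1P q1 yE]].
move=> /(max_decay_measuresP n1 normN Delta0 epsilon0)[r2 [r2P q2 zE]].
move=> /andP[s0 s1]; rewrite yE zE => e.
have ls0 := ltW s0; have ls1 : 0 <= 1 - s by rewrite subr_ge0 ltW.
have rE t : 0 <= t -> rho t = s * r1 t + (1 - s) * r2 t.
  move=> t0; have E : radial rho = radial (fun t => s * r1 t + (1 - s) * r2 t).
    by rewrite e -(radialD n1 normN Delta0 epsilon0).
  exact: (radial_inj n1 normN Delta0 epsilon0 rhoP
    (profileD ls0 ls1 r1P r2P) E t0).
split.
  by apply: (key r1 r2 s) => //; rewrite -yE.
apply: (key r2 r1 (1 - s)) => //; rewrite -?zE//; [lra|lra|].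
by move=> t t0; rewrite rE// opprB addrCA subrr addr0 addrC.
Qed.

Lemma staircase_distributionE g : g <= 1 ->
  staircase_distribution N Delta epsilon g =
  (radial (staircase_profile Delta epsilon g) setT)^-1 *:
    radial (staircase_profile Delta epsilon g).
Proof.
move=> g1; have sP := staircase_profile_profile g1.
have s0 : 0 < staircase_profile Delta epsilon g 0.
  by rewrite staircase_profileE// expR_gt0.
have m0 := radial_mass_gt0 n1 normN Delta0 epsilon0 sP s0.
rewrite -(radialZ n1 normN Delta0 epsilon0) ?invr_ge0 ?(ltW m0)//.
by rewrite (radial_mass n1 normN Delta0 epsilon0).
Qed.

Lemma extreme_points_max_decay : extreme_points D =
  [set staircase_distribution N Delta epsilon g | g in `[0, 1]%classic].
Proof.
apply/seteqP; split=> [m mext|m [g]].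
  have [Dm _] := mext.
  have /(max_decay_measuresP n1 normN Delta0 epsilon0)[rho [rhoP m1 mE]] := Dm.
  rewrite mE in mext m1.
  have two := extreme_two_step n1 normN Delta0 epsilon0 rhoP mext.
  have r0 := profile_gt0 n1 normN Delta0 epsilon0 rhoP m1.
  have [g /andP[g0 g1] rE] := two_step_staircase rhoP r0 two.
  exists g; first by rewrite /= in_itv/= g0.
  have sP := staircase_profile_profile g1.
  have e : radial rho = rho 0 *: radial (staircase_profile Delta epsilon g).
    rewrite -(radialZ n1 normN Delta0 epsilon0) ?(ltW r0)//.
    exact: eq_radial.
  rewrite staircase_distributionE// mE e; congr (_ *: _).
  (* Total mass 1 identifies [rho 0] with the normalizing constant of the staircase. *)
  have : 1 = rho 0 * radial (staircase_profile Delta epsilon g) setT by rewrite -m1 e.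
  move=> re; have s0 : radial (staircase_profile Delta epsilon g) setT != 0.
    by apply/eqP => s0; move/eqP: re; rewrite s0 mulr0 oner_eq0.
  by apply: (mulIf s0); rewrite mulVf// -re.
rewrite /= in_itv/= => /andP[g0 g1] <-; rewrite staircase_distributionE//.
have sP := staircase_profile_profile g1.
have s0 : 0 < staircase_profile Delta epsilon g 0.
  by rewrite staircase_profileE// expR_gt0.
have m0 := radial_mass_gt0 n1 normN Delta0 epsilon0 sP s0.
have mi : 0 <= (radial (staircase_profile Delta epsilon g) setT)^-1.
  by rewrite invr_ge0 ltW.
rewrite -(radialZ n1 normN Delta0 epsilon0)//; apply: two_step_extreme.
- exact: profileZ.
- rewrite (radialZ n1 normN Delta0 epsilon0)//.
  by rewrite -[LHS]/(_^-1 * _) mulVf// gt_eqF.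
- move=> t t0 tD; have [->|->] := staircase_two_step g1 t0 tD; first by left.
  by right; rewrite mulrCA.
Qed.

End staircase.

(** * Compactness *)
Section weak_convergence.

Lemma cvg_initial_topology (S : choiceType) (T : topologicalType) (f : S -> T)
    (F : set_system S) (s : S) : Filter F ->
  f @ F --> f s -> F --> (s : initial_topology f).
Proof.
move=> FF cvf A /= [_ [[B Bop <-] Bfs sBfA]].
have FB : (f @ F) B by apply: cvf; exact: open_nbhs_nbhs.
by rewrite nbhs_filterE; apply: filterS sBfA _.
Qed.

(** The weak topology is initial for [weak_eval], and the product topology is the supremum of the
    initial topologies of its coordinates; both layers are unfolded. *)
Lemma weak_cvg (R : realType) n (F : set_system (signed_measure 'rV[R]_n R))
    (m : signed_measure 'rV[R]_n R) : Filter F ->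
  (forall g : bounded_continuous 'rV[R]_n R,
    (fun k => signed_integral k (sval g)) @ F --> signed_integral m (sval g)) ->
  F --> m.
Proof.
move=> FF cvF; apply: (@cvg_initial_topology _ _ weak_eval).
apply: (iffRL (@cvg_sup _ _ _ _ _ _)) => g.
apply: (@cvg_initial_topology _ _ (fun f => f g)); exact: cvF.
Qed.

End weak_convergence.

Section compactness.
Context {R : realType} {n : nat}.
Variables (N : 'rV[R]_n -> R) (Delta epsilon : R).
Hypotheses (n1 : (1 <= n)%N) (normN : is_norm N).
Hypotheses (Delta0 : 0 < Delta) (epsilon0 : 0 < epsilon).
Implicit Types (rho : R -> R) (t : R).

Local Notation lam := (lebesgue_rV n).
Local Notation profile := (profile Delta epsilon).
Local Notation radial := (radial N).
Local Notation D := (max_decay_measures N Delta epsilon).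

(** On the ball of radius [Delta] the density is at least [expR (- epsilon) * rho 0], and its
    integral there is at most 1. *)
Lemma profile0_bounded : exists2 B, 0 < B & forall rho, profile rho ->
  radial rho setT = 1 -> rho 0 <= B.
Proof.
pose A := [set x | N x < Delta].
have oA : open A.
  apply: (@open_comp _ _ N [set s | s < Delta]) => [y _|]; last exact: open_lt.
  exact: is_norm_continuous.
have mA := open_measurable_rV oA.
have Afin : lam A \is a fin_num.
  rewrite ge0_fin_numE//; apply: (@lebesgue_is_norm_ball_fin _ _ _ normN Delta) => //.
  by move=> x /ltW.
have lamA : 0 < fine (lam A).
  rewrite fine_gt0// open_lebesgue_rV_gt0//=; first by rewrite -ge0_fin_numE.
  by exists 0; rewrite /A/= is_norm0.
exists (expR epsilon / fine (lam A)); first by rewrite divr_gt0 ?expR_gt0.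
move=> rho rhoP m1; have [[r0 nd dec] _] := rhoP.
have [mr _ d] := radial_has_density n1 normN Delta0 epsilon0 rhoP.
have : ((expR (- epsilon) * rho 0)%:E * lam A <= (radial rho setT)%:E)%E.
  rewrite d// -integral_cst//.
  apply: (@le_trans _ _ (\int[lam]_(x in A) (rho (N x))%:E)%E).
    apply: ge0_le_integral => //.
    - by move=> x _; rewrite lee_fin mulr_ge0 ?expR_ge0 ?r0.
    - by apply/measurable_EFinP; exact: measurable_funTS.
    - move=> x /= xD; rewrite lee_fin -dec// add0r nd ?is_norm_ge0//; exact: ltW.
  apply: ge0_subset_integral => //; first exact/measurable_EFinP.
  by move=> x _; rewrite lee_fin r0// is_norm_ge0.
rewrite m1 -(fineK Afin) -EFinM lee_fin ler_pdivlMr//.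
by rewrite -mulrA expRN ler_pdivrMl ?expR_gt0// mulr1.
Qed.

(** * Limits of profiles along an ultrafilter *)

Section ultralimit.
Variables (F : set_system (signed_measure 'rV[R]_n R)) (FU : UltraFilter F).
Variables (r : signed_measure 'rV[R]_n R -> R -> R).
Hypothesis FP : \forall m \near F, profile (r m).
Hypothesis F1 : \forall m \near F, radial (r m) setT = 1.

(** The values eventually lie in the compact segment [[0, B]], hence have a cluster point, and an
    ultrafilter converges to its cluster points. *)
Lemma ultra_profile_cvg t : 0 <= t -> exists l : R, r^~ t @ F --> l.
Proof.
move=> t0; have [B B0 rB] := profile0_bounded.
have FB : (r^~ t @ F) `[0, B]%classic.
  apply: filterS2 FP F1 => m mP m1; have [[r0 nd _] _] := mP.
  by rewrite /= in_itv/= r0//= (le_trans _ (rB _ mP m1))// nd.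
have [l [_ cl]] := @segment_compact R 0 B _ (fmap_proper_filter _ _) FB.
exists l; apply/cvgrPdist_lt => e e0.
have [//|FC] := in_ultra_setVsetC [set m | `|l - r m t| < e] FU.
have FnB : (r^~ t @ F) (~` ball l e) by rewrite -ball_normE.
by have [y []] := cl _ _ FnB (nbhsx_ballx l e e0).
Qed.

Lemma ultra_limit_exists : exists l : R -> R,
  forall t, 0 <= t -> r^~ t @ F --> l t.
Proof.
suff /choice[l lP] : forall t, exists l : R, 0 <= t -> r^~ t @ F --> l by exists l.
move=> t; have [t0|t0] := leP 0 t; last by exists 0.
by have [l rl] := ultra_profile_cvg t0; exists l.
Qed.

Variable l : R -> R.
Hypothesis rl : forall t, 0 <= t -> r^~ t @ F --> l t.

Lemma ultra_limit_ge0 t : 0 <= t -> 0 <= l t.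
Proof.
move=> t0; apply: (ler_cvg_to (cvg_cst 0) (rl t0)).
by apply: filterS FP => m [[r0 _ _] _]; exact: r0.
Qed.

Lemma ultra_limit_le s t : 0 <= s -> s <= t -> l t <= l s.
Proof.
move=> s0 st; apply: (ler_cvg_to (rl (le_trans s0 st)) (rl s0)).
by apply: filterS FP => m [[_ nd _] _]; exact: nd.
Qed.

Lemma ultra_limit_decay t : 0 <= t -> l (t + Delta) = expR (- epsilon) * l t.
Proof.
move=> t0; have tD : 0 <= t + Delta by rewrite addr_ge0// ltW.
apply: (cvg_unique _ (rl tD)) => //.
apply: (@cvg_trans _ ((fun m => expR (- epsilon) * r m t) @ F)).
  apply: near_eq_cvg; apply: filterS FP => m [[_ _ dec] _].
  by rewrite dec.
by apply: cvgMr; exact: rl.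
Qed.

(** As [l] is nonincreasing on the half-line, for [t >= 0] this supremum is its right-hand limit at
    [t]; [l] itself may fail to be right-continuous. *)
Definition right_limit t := sup [set l s | s in [set s | t < s]].

Lemma right_limit_ge s t : 0 <= t -> t < s -> l s <= right_limit t.
Proof.
move=> t0 ts; apply: ub_le_sup; last by exists s.
by exists (l t) => _ [u /ltW tu <-]; exact: ultra_limit_le.
Qed.

Lemma right_limit_le t c : (forall s, t < s -> l s <= c) -> right_limit t <= c.
Proof.
move=> lc; apply: ge_sup; first by exists (l (t + 1)), (t + 1) => //=; rewrite ltrDl.
by move=> _ [u tu <-]; exact: lc.
Qed.

Lemma right_limit_gt t c : c < right_limit t -> exists2 s, t < s & c < l s.
Proof.
move=> ct; have [|_ [s ts <-] cs] := @sup_gt _ [set l s | s in [set s | t < s]] _ _ ct.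
  by exists (l (t + 1)), (t + 1) => //=; rewrite ltrDl.
by exists s.
Qed.

Lemma right_limit_profile : profile right_limit.
Proof.
split; first split.
- move=> t t0; have t1 : t < t + 1 by rewrite ltrDl.
  apply: le_trans (right_limit_ge t0 t1).
  by rewrite ultra_limit_ge0// addr_ge0.
- move=> s t s0 st; apply: right_limit_le => u tu.
  by apply: right_limit_ge => //; exact: le_lt_trans tu.
- move=> t t0; have tD : 0 <= t + Delta by rewrite addr_ge0// ltW.
  apply/eqP; rewrite eq_le; apply/andP; split.
    apply: right_limit_le => u tu.
    have uD : t < u - Delta by rewrite ltrBrDr.
    rewrite -(subrK Delta u) ultra_limit_decay; last by rewrite (le_trans t0)// ltW.
    by rewrite ler_pM2l ?expR_gt0// right_limit_ge.
  rewrite -ler_pdivlMl ?expR_gt0//; apply: right_limit_le => s ts.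
  rewrite ler_pdivlMl ?expR_gt0// -ultra_limit_decay; last by rewrite (le_trans t0)// ltW.
  by rewrite right_limit_ge// ltrD2r.
move=> t c t0 /right_limit_gt[s ts cs].
exists ((t + s) / 2); first lra.
apply: lt_le_trans cs _; apply: right_limit_ge; lra.
Qed.

(* The times at which [l] jumps across the rational [q]. *)
Definition gap (q : rat) : set R :=
  [set t | [/\ 0 <= t, right_limit t < ratr q &
    forall s, 0 <= s -> s < t -> ratr q < l s]].

(** Were [s < t], the value of [l] at their midpoint would be both below [q], by the gap at [s], and
    above it, by the gap at [t]. *)
Lemma gap_subsingleton q s t : gap q s -> gap q t -> s = t.
Proof.
wlog st : s t / s < t.
  by move=> h qs qt; have [/h->//|/h/(_ qt qs)->|] := ltgtP s t.
move=> [s0 sq _] [_ _ tq]; have := tq ((s + t) / 2); have := @right_limit_ge ((s + t) / 2) s s0.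
move=> h1 h2; have {}h1 : l ((s + t) / 2) <= right_limit s by apply: h1; lra.
have {}h2 : ratr q < l ((s + t) / 2) by apply: h2; lra.
lra.
Qed.

(** The exceptional points are the origin and at most one null sphere for each rational. *)
Lemma ae_not_gap : {ae lam, forall x, 0 < N x /\ forall q, ~ gap q (N x)}.
Proof.
have /choice[g gP] (q : rat) : exists u, gap q `<=` [set u].
  have [[u qu]|nq] := pselect (gap q !=set0).
    by exists u => t qt; exact: gap_subsingleton qt qu.
  by exists 0 => t qt; exfalso; apply: nq; exists t.
have null t : lam.-negligible [set x | N x = t].
  exists [set x | N x = t]; split => //; last exact: lebesgue_is_norm_sphere0.
  apply: closed_measurable_rV; apply: (@closed_comp _ _ N [set t]) => [x _|].
    exact: is_norm_continuous.
  exact: closed_eq.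
apply: negligibleS (negligibleU (null 0)
  (negligible_bigcup (fun i => null (g (odflt 0 (unpickle i)))))).
move=> x /= nx; have [Nx0|Nx0] := eqVneq (N x) 0; [by left|right].
have [q qN] : exists q, gap q (N x).
  apply: contrapT => nq; apply: nx; split.
    by rewrite lt_neqAle eq_sym Nx0 is_norm_ge0.
  by move=> q qx; apply: nq; exists q.
by exists (pickle q) => //=; rewrite pickleK/=; exact: gP.
Qed.

(* Enumerates the nonnegative rationals. *)
Definition grid (i : nat) : R := `|ratr (odflt 0 (unpickle i) : rat)|.

Lemma grid_dense a b : 0 <= a -> a < b -> exists i, a < grid i < b.
Proof.
move=> a0 ab; have [q] := rat_in_itvoo ab; rewrite in_itv/= => /andP[aq qb].
exists (pickle q); rewrite /grid pickleK/= ger0_norm ?aq//.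
by rewrite (le_trans a0)// ltW.
Qed.

(** Squeeze: by monotonicity [u j t] lies between the values at two grid points surrounding [t],
    where [l] is within [e / 2] of [right_limit t]; convergence at these points uses the other half
    of [e]. *)
Lemma cvg_right_limit (u : nat -> R -> R) t :
  (forall j, profile (u j)) -> (forall i, u^~ (grid i) @ \oo --> l (grid i)) ->
  0 < t -> (forall q, ~ gap q t) -> u^~ t @ \oo --> right_limit t.
Proof.
move=> uP ul t0 tgap; apply/cvgrPdist_lt => e e0.
have e2 : 0 < e / 2 by rewrite divr_gt0.
have [|s ts rs] := @right_limit_gt t (right_limit t - e / 2); first lra.
have [i /andP[ti is_]] := grid_dense (ltW t0) ts.
have [|q] := @rat_in_itvoo R (right_limit t) (right_limit t + e / 2); first lra.
rewrite in_itv/= => /andP[tq qe].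
(* The absence of a gap at [q] controls [l] from the left of [t]. *)
have [s' s'0 [s't sq]] : exists2 s', 0 <= s' & s' < t /\ l s' <= ratr q.
  apply: contrapT => ns; apply: (tgap q); split => //; first exact: ltW.
  move=> s' s'0 s't; rewrite ltNge; apply/negP => sq; apply: ns.
  by exists s'.
have [i' /andP[si it]] := grid_dense s'0 s't.
have /cvgrPdist_lt/(_ _ e2) hi := ul i.
have /cvgrPdist_lt/(_ _ e2) hi' := ul i'.
apply: filterS2 hi hi' => j; rewrite !ltr_norml => /andP[_ h1] /andP[h2 _].
have [[_ nd _] _] := uP j.
have u1 := nd _ _ (ltW t0) (ltW ti).
have u2 := nd _ _ (le_trans s'0 (ltW si)) (ltW it).
have l1 := ultra_limit_le (le_trans (ltW t0) (ltW ti)) (ltW is_).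
have l2 := ultra_limit_le s'0 (ltW si).
by apply/andP; split; lra.
Qed.

(** Dominated convergence: normalized profiles share one exponential envelope, by the uniform bound
    on their values at 0. *)
Lemma cvg_integral_profile (u : nat -> R -> R) (g : 'rV[R]_n -> R) :
  continuous g -> bounded_fun g -> (forall j, profile (u j)) ->
  (forall j, radial (u j) setT = 1) ->
  (forall i, u^~ (grid i) @ \oo --> l (grid i)) ->
  (fun j => \int[lam]_x (g x * u j (N x))) @ \oo -->
  \int[lam]_x (g x * right_limit (N x)).
Proof.
move=> cg [C0 [_ gC]] uP u1 ul.
have mg := continuous_measurable_rV cg.
pose C := `|C0| + 1.
have {}gC x : `|g x| <= C.
  by apply: gC => //; rewrite /C (le_lt_trans (ler_norm _))// ltrDl.
have C_ge0 : 0 <= C by rewrite addr_ge0.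
have [B B0 uB] := profile0_bounded.
have mf rho : profile rho ->
    measurable_fun setT (fun x => (g x * rho (N x))%:E).
  move=> rhoP; apply/measurable_EFinP; apply: measurable_funM => //.
  exact: (measurable_profile normN rhoP).
have cvgf : {ae lam, forall x, setT x ->
    (fun j => (g x * u j (N x))%:E) @ \oo --> (g x * right_limit (N x))%:E}.
  apply: filterS ae_not_gap => x [x0 xgap] _; apply: cvg_EFin; first exact: nearW.
  by apply: cvgMr; exact: cvg_right_limit.
have dom : {ae lam, forall x j, setT x -> (`|(g x * u j (N x))%:E| <=
    (C * (expR epsilon * B) * expR (- (epsilon / Delta) * N x))%:E)%E}.
  apply: aeW => x j _; rewrite lee_fin normrM -mulrA ler_pM//.
  have [decj _] := uP j; rewrite ger0_norm; last exact: (profile_ge0 normN).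
  apply: le_trans (maximal_decay_ub Delta0 epsilon0 decj (is_norm_ge0 normN x)) _.
  by rewrite ler_wpM2r ?expR_ge0// ler_wpM2l ?expR_ge0// uB.
have [fi _ dc] := dominated_convergence measurableT (fun j => mf _ (uP j))
  (mf _ right_limit_profile) cvgf
  (integrable_envelope n1 normN Delta0 epsilon0 (C * (expR epsilon * B))) dom.
apply: fine_cvg; rewrite /Rintegral fineK//.
exact: (integrable_fin_num measurableT fi).
Qed.

(** Dominated convergence is about sequences. If convergence along the ultrafilter failed, a large
    set would keep the integrals at distance at least [e] from the limit, and a sequence extracted
    from it gives a contradiction. *)
Lemma ultra_integral_cvg (g : 'rV[R]_n -> R) : continuous g -> bounded_fun g ->
  (fun m => \int[lam]_x (g x * r m (N x))) @ F -->
  \int[lam]_x (g x * right_limit (N x)).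
Proof.
move=> cg bg; apply/cvgrPdist_lt => e e0.
pose I := \int[lam]_x (g x * right_limit (N x)).
pose J m := \int[lam]_x (g x * r m (N x)).
have [//|FC] := in_ultra_setVsetC [set m | `|I - J m| < e] FU.
exfalso.
(* The [j]-th term is [1 / (j + 1)]-close to [l] at the first [j + 1] grid points; a finite
   intersection of large sets is nonempty. *)
have /choice[w wP] j : exists m, [/\ profile (r m), radial (r m) setT = 1,
    ~ (`|I - J m| < e) &
    forall i : 'I_j.+1, `|l (grid i) - r m (grid i)| < j.+1%:R^-1].
  have Fg : F [set m | forall i : 'I_j.+1, `|l (grid i) - r m (grid i)| < j.+1%:R^-1].
    apply: filter_forall => i; have gi : 0 <= grid i by exact: normr_ge0.
    have /cvgrPdist_lt := rl gi; apply.
    by rewrite invr_gt0.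
  have [m [[mP m1] [me mg]]] := filter_ex (filterI (filterI FP F1) (filterI FC Fg)).
  by exists m.
have wl i : (fun j => r (w j) (grid i)) @ \oo --> l (grid i).
  apply/cvgrPdist_lt => d d0; exists (maxn i (Num.truncn d^-1)) => // j /=.
  rewrite geq_max => /andP[ij dj]; have [_ _ _ /(_ (Ordinal (ij : (i < j.+1)%N)))] := wP j.
  move=> /= /lt_trans; apply; rewrite invf_plt ?posrE//.
  by apply: lt_le_trans (truncnS_gt _) _; rewrite ler_nat ltnS.
have wp j : profile (r (w j)) by case: (wP j).
have w1 j : radial (r (w j)) setT = 1 by case: (wP j).
have := cvg_integral_profile cg bg wp w1 wl.
move=> /cvgrPdist_lt/(_ _ e0)[k _ /(_ k (leqnn _))/= h].
by have [_ _ + _] := wP k.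
Qed.

End ultralimit.

Lemma compact_max_decay : compact D.
Proof.
rewrite compact_ultra => F FU FD.
(* The value chosen outside [D] is arbitrary, since [D] belongs to the ultrafilter. *)
have /choice[r rP] (m : signed_measure 'rV[R]_n R) : exists rho, D m ->
    [/\ profile rho, radial rho setT = 1 & m = radial rho].
  have [Dm|nDm] := pselect (D m); last by exists (fun=> 0).
  have [rho [rhoP m1 mE]] := iffLR (max_decay_measuresP n1 normN Delta0 epsilon0 m) Dm.
  by exists rho; rewrite -mE.
have FP : \forall m \near F, profile (r m) by apply: filterS FD => m /rP[].
have F1 : \forall m \near F, radial (r m) setT = 1 by apply: filterS FD => m /rP[].
have FE : \forall m \near F, m = radial (r m) by apply: filterS FD => m /rP[].
have [l rl] := ultra_limit_exists FU FP F1.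
have limP := right_limit_profile FU FP rl.
(* Testing against the constant function 1 shows that no mass is lost in the limit. *)
have lim1 : radial (right_limit l) setT = 1.
  have c1 : continuous (cst 1 : 'rV[R]_n -> R) by move=> x; exact: cst_continuous.
  have b1 : bounded_fun (cst 1 : 'rV[R]_n -> R).
    by exists 1; split => // M M1 x _ /=; rewrite normr1 ltW.
  have h := ultra_integral_cvg FU FP F1 rl c1 b1.
  rewrite (radial_mass n1 normN Delta0 epsilon0)//.
  have -> : \int[lam]_x right_limit l (N x) = \int[lam]_x (cst 1 x * right_limit l (N x)).
    by apply: eq_Rintegral => x _; rewrite /= mul1r.
  apply: (cvg_unique _ h) => //.
  apply: (@cvg_trans _ ((fun=> 1 : R) @ F)); last exact: cvg_cst.
  apply: near_eq_cvg; apply: filterS2 FP F1 => m mP m1.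
  rewrite -[LHS]m1 (radial_mass n1 normN Delta0 epsilon0)//.
  by apply: eq_Rintegral => x _; rewrite /= mul1r.
exists (radial (right_limit l)); split.
  exact: (radial_mem n1 normN Delta0 epsilon0).
apply: weak_cvg => -[g [cg bg]] /=.
have mg := continuous_measurable_rV cg.
rewrite (signed_integral_density (radial_has_density n1 normN Delta0 epsilon0 limP) mg bg).
apply: cvg_trans (ultra_integral_cvg FU FP F1 rl cg bg).
apply: near_eq_cvg; apply: filterS2 FP FE => m mP mE.
by rewrite [in RHS]mE (signed_integral_density (radial_has_density n1 normN Delta0 epsilon0 mP) mg bg).
Qed.

End compactness.

Theorem theorem5 (R : realType) (n : nat) (N : 'rV[R]_n -> R)
    (Delta epsilon : R) (n_ge1 : (1 <= n)%N) (normN : is_norm N)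
    (Delta_gt0 : 0 < Delta) (epsilon_gt0 : 0 < epsilon) :
  [/\ convex_set (max_decay_measures N Delta epsilon),
      compact (max_decay_measures N Delta epsilon) &
      extreme_points (max_decay_measures N Delta epsilon) =
      [set staircase_distribution N Delta epsilon gamma |
        gamma in `[0, 1]%classic]].
Proof.
split.
- exact: convex_max_decay.
- exact: compact_max_decay.
- exact: extreme_points_max_decay.
Qed.
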